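(* Let $m\ge 1$ and let $\mathcal G_m$ be a random graph on the vertex set $[m]=\{1,\dots,m\}$ in which, for distinct $\alpha,\beta\in[m]$, the edge $\{\alpha,\beta\}$ is present with probability $p_{\{\alpha,\beta\}}\in[0,1]$, all edges being independent. Let $M_\alpha$ be the degree of vertex $\alpha$. Let $w_\alpha>0$ and $d_\alpha\in\mathbb Z$, $\alpha\in[m]$, be constants, put $|\mathbf w|=\max_\alpha w_\alpha$, $|\mathbf d|=\max_\alpha d_\alpha$, and $$Y_{ge}=\sum_{\alpha\in[m]}w_\alpha\mathbf 1(M_\alpha\ge d_\alpha),\qquad Y_{ne}=\sum_{\alpha\in[m]}w_\alpha\mathbf 1(M_\alpha\ne d_\alpha).$$ Suppose that all indicator summands of the sum under consideration are non-constant, that is, $0<P(M_\alpha\ge d_\alpha)<1$ for all $\alpha$ when considering $Y_{ge}$, and $0<P(M_\alpha\ne d_\alpha)<1$ for all $\alpha$ when considering $Y_{ne}$. Then, for $(Y,\mu,c)=(Y_{ge},\mu_{ge},c_{ge})$ and for $(Y,\mu,c)=(Y_{ne},\mu_{ne},c_{ne})$, where $$\mu_{ge}=EY_{ge}=\sum_{\alpha\in[m]}w_\alpha q_{ge}(d_\alpha,\mathbf p_\alpha),\quad \mu_{ne}=EY_{ne}=\sum_{\alpha\in[m]}w_\alpha q_{ne}(d_\alpha,\mathbf p_\alpha),\quad c_{ge}=|\mathbf w|(|\mathbf d|+1),\quad c_{ne}=2|\mathbf w|,$$ the following inequalities hold: (i) $P(Y-\mu\le -t)\le \exp\left(-\frac{t^2}{2c\mu}\right)$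 for all $t>0$; (ii) $P(Y-\mu\ge t)\le \exp\left(-\frac{t^2}{2c\mu+ct}\right)$ for all $t>0$; (iii) $P(Y-\mu\ge t)\le \left(\frac{\mu}{\mu+t}\right)^{(t+\mu)/c}e^{t/c}$ for all $t\ge0$, and $P(Y-\mu\le t)\le \left(\frac{\mu}{\mu+t}\right)^{(t+\mu)/c}e^{t/c}$ for all $-\mu\le t\le 0$ (the right side being read as $e^{-\mu/c}$ at $t=-\mu$); (iv) $P(Y-\mu\ge t)\le \exp\left(-\frac{t^2}{2c\mu+2ct/3}\right)$ for all $t>0$.
   Context: $\mathbf p_\alpha=(p_{\{\alpha,\beta\}})_{\beta\in[m]\setminus\{\alpha\}}$. For a finite vector $\mathbf p=(p_j)_{j\in J}$ of probabilities, $q_{eq}(k,\mathbf p)=\sum_{s\subset J,|s|=k}\prod_{j\in s}p_j\prod_{j\in J\setminus s}(1-p_j)$ is the probability that a sum of independent Bernoulli($p_j$) variables, $j\in J$, equals $k$; $q_{ge}(d,\mathbf p)=\sum_{k\ge d}q_{eq}(k,\mathbf p)$ and $q_{ne}(d,\mathbf p)=1-q_{eq}(d,\mathbf p)$. *)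

(* Defs.v *)
From HB Require Import structures.
From mathcomp Require Import all_boot all_order all_algebra.
From mathcomp Require Import all_classical all_reals all_analysis.
Set Implicit Arguments.
Unset Strict Implicit.
Unset Printing Implicit Defensive.
Import Order.TTheory GRing.Theory Num.Theory.
Local Open Scope ring_scope.

(* The product rule is required for every subfamily, so this is mutual
   (not merely pairwise) independence. *)
Definition mutually_independent (R : realType) (d : measure_display)
    (T : measurableType d) (P : probability T R)
    (I : finType) (J : {set I}) (A : I -> set T) : Prop :=
  forall S : {set I}, S \subset J ->
    P (\bigcap_(i in [set` S]) A i)%classic
    = (\prod_(i in S) fine (P (A i)))%:E.

(* Vertices are 'I_m, an edge is a 2-element set of vertices, and a simple
   graph on 'I_m is given by its set of edges. *)
Definition edges (m : nat) : {set {set 'I_m}} :=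
  [set e : {set 'I_m} | #|e| == 2%N]%SET.

Definition edge_event (T : Type) (m : nat) (G : T -> {set {set 'I_m}})
    (e : {set 'I_m}) : set T :=
  [set x | e \in G x]%classic.

Record is_random_graph (R : realType) (d : measure_display)
    (T : measurableType d) (P : probability T R) (m : nat)
    (p : {set 'I_m} -> R) (G : T -> {set {set 'I_m}}) : Prop :=
  IsRandomGraph {
    rg_simple : forall x, G x \subset edges m;
    rg_measurable : forall e, e \in edges m -> measurable (edge_event G e);
    rg_prob : forall e, e \in edges m -> P (edge_event G e) = (p e)%:E;
    rg_indep : mutually_independent P (edges m) (edge_event G)
  }.

Definition degree (m : nat) (g : {set {set 'I_m}}) (a : 'I_m) : nat :=
  #|[set b : 'I_m | (b != a) && ([set a; b]%SET \in g)]%SET|.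

Definition q_eq (R : realType) (I : finType) (J : {set I}) (p : I -> R)
    (k : int) : R :=
  \sum_(s : {set I} | (s \subset J) && (#|s|%:Z == k))
    (\prod_(j in s) p j) * (\prod_(j in (J :\: s)%SET) (1 - p j)).

(* q_eq J p k = 0 unless 0 <= k <= #|J|, so the sum over all integers k >= d
   is restricted to this range. *)
Definition q_ge (R : realType) (I : finType) (J : {set I}) (p : I -> R)
    (d : int) : R :=
  \sum_(k < #|J|.+1 | d <= k%:Z) q_eq J p k%:Z.

Definition q_ne (R : realType) (I : finType) (J : {set I}) (p : I -> R)
    (d : int) : R :=
  1 - q_eq J p d.

(* Maximum over the nonempty index set 'I_m; the base point makes it correct
   for negative values as well. *)
Definition vmax (disp : Order.disp_t) (V : orderType disp) (m : nat)
    (hm : (0 < m)%N) (f : 'I_m -> V) : V :=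
  \big[Order.max/f (Ordinal hm)]_(a < m) f a.

Section Statistics.
Context {R : realType} {T : Type} {m : nat}.
Variables (G : T -> {set {set 'I_m}}) (p : {set 'I_m} -> R).
Variables (w : 'I_m -> R) (dg : 'I_m -> int).

Definition ge_event (a : 'I_m) : set T :=
  [set x | dg a <= (degree (G x) a)%:Z]%classic.

Definition ne_event (a : 'I_m) : set T :=
  [set x | (degree (G x) a)%:Z != dg a]%classic.

Definition Y_ge (x : T) : R := \sum_(a < m) w a * \1_(ge_event a) x.

Definition Y_ne (x : T) : R := \sum_(a < m) w a * \1_(ne_event a) x.

Definition mu_ge : R :=
  \sum_(a < m) w a * q_ge [set~ a]%SET (fun b => p [set a; b]%SET) (dg a).

Definition mu_ne : R :=
  \sum_(a < m) w a * q_ne [set~ a]%SET (fun b => p [set a; b]%SET) (dg a).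

Definition c_ge (hm : (0 < m)%N) : R := vmax hm w * (vmax hm dg + 1)%:~R.

Definition c_ne (hm : (0 < m)%N) : R := 2 * vmax hm w.
End Statistics.

Definition nonconstant_events (R : realType) (d : measure_display)
    (T : measurableType d) (P : probability T R) (m : nat)
    (A : 'I_m -> set T) : Prop :=
  forall a, (0 < P (A a) < 1)%E.

(* The bound (mu / (mu + t)) ^ ((t + mu) / c) * exp (t / c), read as
   exp (- mu / c) at t = - mu. *)
Definition poisson_bound (R : realType) (mu c t : R) : R :=
  if t == - mu then expR (- mu / c)
  else powR (mu / (mu + t)) ((t + mu) / c) * expR (t / c).

Record concentrated (R : realType) (d : measure_display)
    (T : measurableType d) (P : probability T R) (Y : T -> R) (mu c : R)
    : Prop :=
  Concentrated {
    lower_gauss : forall t : R, 0 < t ->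
      (P [set x | (Y x - mu <= - t)%R]%classic
       <= (expR (- (t ^+ 2 / (2 * c * mu))))%:E)%E;
    upper_gauss : forall t : R, 0 < t ->
      (P [set x | (t <= Y x - mu)%R]%classic
       <= (expR (- (t ^+ 2 / (2 * c * mu + c * t))))%:E)%E;
    upper_poisson : forall t : R, 0 <= t ->
      (P [set x | (t <= Y x - mu)%R]%classic <= (poisson_bound mu c t)%:E)%E;
    lower_poisson : forall t : R, - mu <= t <= 0 ->
      (P [set x | (Y x - mu <= t)%R]%classic <= (poisson_bound mu c t)%:E)%E;
    upper_bernstein : forall t : R, 0 < t ->
      (P [set x | (t <= Y x - mu)%R]%classic
       <= (expR (- (t ^+ 2 / (2 * c * mu + 2 * c * t / 3))))%:E)%E
  }.

(* Main.v *)
(** The mechanism is a bounded size bias: conditioning [G] on the event at the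
    vertex [a] multiplies the exponential moment [E (exp (s * Y))] by at most
    [exp (s * c)] for [s >= 0], and by at least [exp (s * c)] for [s <= 0].
    Weighted by [w a] and summed over [a], this bounds [m' s] by
    [mu * exp (c * s) * m s] for the moment generating function [m], hence
    [m s <= exp (mu / c * (exp (c * s) - 1))], and all five inequalities are
    Chernoff bounds.

    For the conditioning estimate, take an independent copy [h] of the graph [g]
    and exchange the edges at [a] on a uniformly random subset of the places
    where [g] and [h] differ. Given the common part, the edges of [g] at [a]
    are then a uniformly random subset of a fixed set, and those of [h] its
    complement, so that averaging over the subsets of each size leaves an
    inequality between sums with binomial weights. The latter only uses that
    one more edge at [a] changes the degree of a single other vertex, by one,
    together with the unimodality of binomial coefficients. *)
Require Import Defs.
From HB Require Import structures.
From mathcomp Require Import all_boot all_order all_algebra.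
From mathcomp Require Import all_classical all_reals all_analysis.
From mathcomp Require Import measurable_realfun.
From mathcomp Require Import ring lra zify.
Set Implicit Arguments.
Unset Strict Implicit.
Unset Printing Implicit Defensive.
Import Order.TTheory GRing.Theory Num.Theory.
Local Open Scope ring_scope.

(** * Sums with binomial weights *)

Lemma leq_bin_succ (n k : nat) : (k.*2 < n)%N -> ('C(n, k) <= 'C(n, k.+1))%N.
Proof.
move=> kn; rewrite -(leq_pmul2l (ltn0Sn k)) mul_bin_left leq_mul2r.
by apply/orP; right; lia.
Qed.

Lemma leq_bin_half (n k l : nat) :
  (k <= l)%N -> (l.*2 <= n)%N -> ('C(n, k) <= 'C(n, l))%N.
Proof.
elim: l => [|l IH]; first by rewrite leqn0 => /eqP ->.
rewrite leq_eqVlt => /predU1P[-> //|kl] ln.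
by apply: (@leq_trans 'C(n, l)); [apply: IH | apply: leq_bin_succ]; lia.
Qed.

(** Unimodality in a symmetric form: the hypotheses say that [l] is at least as close to [n / 2] as
    [k]. Beyond the middle, [l] is reflected to [n - l], which is still at least [k]. *)
Lemma leq_bin_add (n k l : nat) :
  (k <= l)%N -> (k + l <= n)%N -> ('C(n, k) <= 'C(n, l))%N.
Proof.
move=> kl kln; have [ln|ln] := leqP l.*2 n; first exact: leq_bin_half.
rewrite -(@bin_sub n l) ?leq_bin_half //; lia.
Qed.

Section LevelInequalities.
Variable R : realFieldType.
Implicit Types (f : nat -> R) (n d i : nat).

Let nondecr n f : (forall k, (k < n)%N -> f k <= f k.+1) ->
  forall k l, (k <= l)%N -> (l <= n)%N -> f k <= f l.
Proof.
move=> fS k; elim=> [|l IH]; first by rewrite leqn0 => /eqP ->.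
rewrite leq_eqVlt => /predU1P[-> //|kl] ln.
by apply: (@le_trans _ _ (f l)); [apply: IH | apply: fS]; lia.
Qed.

(** A rearrangement inequality. Since [j + (L - j) = L <= n], the differences
    ['C(n, j) - 'C(n, L - j)] and [f j - f (L - j)] have the same sign; the sum of their products is
    twice the difference of the two sides. *)
Lemma binomial_shift_le n (L : nat) f : (L <= n)%N ->
  (forall k, (k < n)%N -> f k <= f k.+1) ->
  \sum_(j < L.+1) 'C(n, L - j)%:R * f j <= \sum_(j < L.+1) 'C(n, j)%:R * f j.
Proof.
move=> Ln /nondecr fmono.
have rv (g : nat -> R) : \sum_(j < L.+1) g (L - j)%N = \sum_(j < L.+1) g j.
  rewrite [RHS](reindex_inj rev_ord_inj) /=.
  by apply: eq_bigr => j _; rewrite subSS.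
have: 0 <= \sum_(j < L.+1)
    ('C(n, j)%:R - 'C(n, L - j)%:R) * (f j - f (L - j)%N) :> R.
  apply: sumr_ge0 => j _; have jL : (j <= L)%N by rewrite -ltnS.
  have [jl|jl] := leqP j (L - j).
    apply: mulr_le0; rewrite subr_le0 ?ler_nat ?leq_bin_add ?fmono //; lia.
  apply: mulr_ge0; rewrite subr_ge0 ?ler_nat ?leq_bin_add ?fmono //; lia.
have -> : \sum_(j < L.+1) ('C(n, j)%:R - 'C(n, L - j)%:R) * (f j - f (L - j)%N) =
   \sum_(j < L.+1) 'C(n, j)%:R * f j
   + \sum_(j < L.+1) ('C(n, L - j)%:R * f (L - j)%N)
   - (\sum_(j < L.+1) 'C(n, L - j)%:R * f j
      + \sum_(j < L.+1) 'C(n, j)%:R * f (L - j)%N).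
  rewrite -!big_split /= -sumrB; apply: eq_bigr => j _; ring.
rewrite (rv (fun j => 'C(n, j)%:R * f j)).
have -> : \sum_(j < L.+1) 'C(n, j)%:R * f (L - j)%N =
          \sum_(j < L.+1) 'C(n, L - j)%:R * f j.
  rewrite -(rv (fun j => 'C(n, L - j)%:R * f j)).
  by apply: eq_bigr => j _; rewrite subKn // -ltnS.
set X := \sum_(_ < _) _; set Y := \sum_(_ < _) _; lra.
Qed.

(** Lowering the argument of [f] by the threshold costs at most one factor [b] per unit. By the
    symmetry of binomial coefficients, both sums then run over the same values of [f], with weights
    in opposite orders, which [binomial_shift_le] compares. *)
Lemma binomial_tail_le n d i (b : R) f : 1 <= b ->
  (forall k, 0 <= f k) ->
  (forall k, (k < n)%N -> f k <= f k.+1 <= b * f k) ->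
  \sum_(k < n.+1 | (d <= i + k)%N) 'C(n, k)%:R * f k <=
  b ^+ d * \sum_(k < n.+1 | (d <= i + k)%N) 'C(n, k)%:R * f (n - k)%N.
Proof.
move=> b1 f0 fS; have b0 : 0 <= b by rewrite (le_trans ler01).
have f1 k : (k < n)%N -> f k <= f k.+1 by move=> /fS/andP[].
have f2 k j : (k + j <= n)%N -> f (k + j)%N <= b ^+ j * f k.
  elim: j => [|j IH] kj; first by rewrite addn0 expr0 mul1r.
  rewrite addnS in kj *; have /andP[_ /le_trans->//] := fS _ kj.
  by rewrite exprS -mulrA ler_wpM2l // IH // ltnW.
(* The subtraction is truncated: when [d <= i] the sum is over all levels. In every case [d' <= d],
   so that [b ^+ d' <= b ^+ d] at the end. *)
set d' := (d - i)%N.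
have eS (g : nat -> R) : \sum_(k < n.+1 | (d <= i + k)%N) g k =
                         \sum_(d' <= k < n.+1) g k.
  rewrite big_geq_mkord /=; apply: eq_bigl => k /=; rewrite /d'; lia.
rewrite (eS (fun k => 'C(n, k)%:R * f k)).
rewrite (eS (fun k => 'C(n, k)%:R * f (n - k)%N)).
have [d'n|nd'] := leqP d' n; last by rewrite !big_geq ?mulr0.
set L := (n - d')%N; have nE : n = (L + d')%N by rewrite /L; lia.
have eL : (n.+1 = L.+1 + d')%N by lia.
have shift (g : nat -> R) :
    \sum_(d' <= k < n.+1) g k = \sum_(j < L.+1) g (j + d')%N.
  rewrite -[d' in LHS]add0n eL big_addn addnK big_mkord //.
rewrite !shift.
have s0 : 0 <= \sum_(j < L.+1) 'C(n, (j + d')%N)%:R * f (n - (j + d'))%N.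
  by apply: sumr_ge0 => j _; rewrite mulr_ge0.
apply: (@le_trans _ _ (b ^+ d' * \sum_(j < L.+1) 'C(n, L - j)%:R * f j)).
  rewrite mulr_sumr; apply: ler_sum => j _; have jL := ltn_ord j.
  have -> : 'C(n, L - j) = 'C(n, (j + d')%N).
    rewrite -(@bin_sub n (j + d')); first by congr 'C(_, _); lia.
    lia.
  rewrite mulrCA ler_wpM2l // f2 //; lia.
apply: (@le_trans _ _ (b ^+ d' * \sum_(j < L.+1) 'C(n, j)%:R * f j)).
  rewrite ler_wpM2l ?exprn_ge0 // binomial_shift_le //; lia.
rewrite [leLHS]mulrC [leRHS]mulrC.
have -> : \sum_(j < L.+1) 'C(n, (j + d')%N)%:R * f (n - (j + d'))%N =
          \sum_(j < L.+1) 'C(n, j)%:R * f j.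
  rewrite [RHS](reindex_inj rev_ord_inj) /=.
  apply: eq_bigr => j _; have jL := ltn_ord j; rewrite subSS.
  rewrite -(@bin_sub n (j + d')); last lia.
  by congr ('C(_, _)%:R * f _); lia.
rewrite ler_wpM2l ?ler_weXn2l // /d'; last lia.
by apply: sumr_ge0 => j _; rewrite mulr_ge0.
Qed.

(** The reflection [k |-> n - k] turns decrease by a factor at least [a] into increase by a factor
    at most [a^-1], which reduces this to [binomial_tail_le]. *)
Lemma binomial_tail_ge n d i (a : R) f : 0 < a <= 1 ->
  (forall k, 0 <= f k) ->
  (forall k, (k < n)%N -> a * f k <= f k.+1 <= f k) ->
  a ^+ d * \sum_(k < n.+1 | (d <= i + k)%N) 'C(n, k)%:R * f (n - k)%N <=
  \sum_(k < n.+1 | (d <= i + k)%N) 'C(n, k)%:R * f k.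
Proof.
move=> /andP[a0 a1] f0 fS.
rewrite mulrC -ler_pdivlMr ?exprn_gt0 // mulrC -exprVn.
have := @binomial_tail_le n d i a^-1 (fun k => f (n - k)%N).
rewrite (eq_bigr (fun k : 'I_n.+1 => 'C(n, k)%:R * f (n - k)%N)) //.
have -> : \sum_(k < n.+1 | (d <= i + k)%N) 'C(n, k)%:R * f (n - (n - k))%N =
   \sum_(k < n.+1 | (d <= i + k)%N) 'C(n, k)%:R * f k.
  by apply: eq_bigr => k _; rewrite subKn // -ltnS.
apply=> //; first by rewrite invf_ge1.
move=> k kn; have eK : (n - k = (n - k.+1).+1)%N by lia.
have /andP[h1 h2] : a * f (n - k.+1)%N <= f (n - k)%N <= f (n - k.+1)%N.
  by rewrite eK; apply: fS; lia.
by rewrite h2 /= mulrC ler_pdivlMr // mulrC.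
Qed.

(** Telescoping: [f k.+1 - f k <= (b - 1) * f k], and symmetrically
    [f k - f k.+1 <= (b - 1) * f k.+1]. The remaining endpoint term is [(b - 1) * f l'] or
    [(b - 1) * f l]. *)
Let path_sum_ge (b : R) f l l' : (l <= l')%N ->
  (forall k, (l <= k < l')%N -> f k <= b * f k.+1 /\ f k.+1 <= b * f k) ->
  b * f l' - f l <= (b - 1) * \sum_(l <= k < l'.+1) f k /\
  b * f l - f l' <= (b - 1) * \sum_(l <= k < l'.+1) f k.
Proof.
elim: l' => [|l' IH].
  by rewrite leqn0 => /eqP -> _; rewrite big_nat1; split; lra.
rewrite leq_eqVlt => /predU1P[-> _|ll' fS].
  by rewrite big_nat1; split; lra.
have [|k kl'|h1 h2] := IH; [lia | by apply: fS; lia |].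
have [|h3 h4] := fS l'; first lia.
rewrite big_nat_recr /=; last lia.
move: h1 h2 h3 h4; set X := \sum_(_ <= _ < _) _; split; lra.
Qed.

(** After reflecting the right side, the two sums are the full sum without the term at one level
    [e], respectively at [n - e]. The discrepancy [b * f (n - e) - f e] is paid for along the path
    between these levels, where the binomial coefficients are at least ['C(n, e)]. *)
Lemma binomial_hole_le n (d : int) i (b : R) f : 1 <= b ->
  (forall k, 0 <= f k) ->
  (forall k, (k < n)%N -> f k <= b * f k.+1 /\ f k.+1 <= b * f k) ->
  \sum_(k < n.+1 | (i + k)%N%:Z != d) 'C(n, k)%:R * f k <=
  b * \sum_(k < n.+1 | (i + k)%N%:Z != d) 'C(n, k)%:R * f (n - k)%N.
Proof.
move=> b1 f0 fS.
have flip (P : pred nat) : \sum_(k < n.+1 | P k) 'C(n, k)%:R * f (n - k)%N =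
    \sum_(k < n.+1 | P (n - k)%N) 'C(n, k)%:R * f k.
  rewrite (reindex_inj rev_ord_inj) /=.
  apply: eq_big => [k|k _]; rewrite subSS // bin_sub ?subKn // -ltnS //.
rewrite (flip (fun k => (i + k)%N%:Z != d)) /=.
have s0 : 0 <= \sum_(k < n.+1) 'C(n, k)%:R * f k.
  by apply: sumr_ge0 => j _; rewrite mulr_ge0.
(* If [d - i] is not in the range from [0] to [n], nothing is excluded on either side and [1 <= b]
   suffices. *)
have [[e ed]|nex] := pselect (exists e : 'I_n.+1, (i + e)%N%:Z = d); last first.
  rewrite [leLHS](eq_bigl xpredT) => [|k]; last first.
    by apply/negP => /eqP kd; apply: nex; exists k.
  rewrite [X in b * X](eq_bigl xpredT) ?ler_peMl // => k.
  by apply/negP => /eqP kd; apply: nex; exists (rev_ord k); rewrite -kd /= subSS.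
have eS (g : nat -> R) : \sum_(k < n.+1 | (i + k)%N%:Z != d) g k =
    \sum_(k < n.+1) g k - g e.
  rewrite [X in _ = X - _](bigD1 e) //= [g e + _]addrC addrK.
  apply: eq_bigl => k; rewrite -ed -val_eqE /=; lia.
have eS' (g : nat -> R) : \sum_(k < n.+1 | (i + (n - k))%N%:Z != d) g k =
    \sum_(k < n.+1) g k - g (n - e)%N.
  rewrite [X in _ = X - _](bigD1 (rev_ord e)) //= subSS [g (n - e)%N + _]addrC addrK.
  apply: eq_bigl => k; rewrite -ed -val_eqE /= subSS.
  have := ltn_ord e; have := ltn_ord k; lia.
rewrite (eS (fun k => 'C(n, k)%:R * f k)) (eS' (fun k => 'C(n, k)%:R * f k)).
have en : (e <= n)%N by rewrite -ltnS.
rewrite bin_sub //.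
suff: 'C(n, e)%:R * (b * f (n - e)%N - f e) <=
      (b - 1) * \sum_(k < n.+1) 'C(n, k)%:R * f k.
  by set X := \sum_(_ < _) _; lra.
pose l := minn e (n - e); pose l' := maxn e (n - e).
have ll' : (l <= l')%N by rewrite /l /l'; lia.
have l'n : (l' <= n)%N by rewrite /l'; lia.
have [|h1 h2] := @path_sum_ge b f l l' ll'.
  by move=> k kl; apply: fS; lia.
have h3 : b * f (n - e)%N - f e <= (b - 1) * \sum_(l <= k < l'.+1) f k.
  have [ee|ee] := leqP e (n - e).
    have [-> ->] : e = l :> nat /\ (n - e)%N = l' by rewrite /l /l'; lia.
    exact: h1.
  have [-> ->] : e = l' :> nat /\ (n - e)%N = l by rewrite /l /l'; lia.
  exact: h2.
apply: (@le_trans _ _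
    ('C(n, e)%:R * ((b - 1) * \sum_(l <= k < l'.+1) f k))).
  by rewrite ler_wpM2l.
rewrite mulrCA ler_wpM2l ?subr_ge0 // mulr_sumr.
apply: (@le_trans _ _ (\sum_(l <= k < l'.+1) 'C(n, k)%:R * f k)).
  apply: ler_sum_nat => k kl; rewrite ler_wpM2r // ler_nat.
  have [ee|ee] := leqP e (n - e).
    by apply: leq_bin_add; move: kl; rewrite /l /l'; lia.
  rewrite -(bin_sub en).
  by apply: leq_bin_add; move: kl; rewrite /l /l'; lia.
(* The levels off the path contribute nonnegative terms to the full sum. *)
rewrite -(big_mkord xpredT (fun k => 'C(n, k)%:R * f k)).
rewrite (@big_cat_nat _ _ _ l 0 n.+1) //=; last lia.
rewrite (@big_cat_nat _ _ _ l'.+1 l n.+1) //=; last lia.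
rewrite addrCA lerDl addr_ge0 //.
  by apply: sumr_ge0 => j _; rewrite mulr_ge0.
by apply: sumr_ge0 => j _; rewrite mulr_ge0.
Qed.

Lemma binomial_hole_ge n (d : int) i (a : R) f : 0 < a <= 1 ->
  (forall k, 0 <= f k) ->
  (forall k, (k < n)%N -> a * f k <= f k.+1 /\ a * f k.+1 <= f k) ->
  a * \sum_(k < n.+1 | (i + k)%N%:Z != d) 'C(n, k)%:R * f (n - k)%N <=
  \sum_(k < n.+1 | (i + k)%N%:Z != d) 'C(n, k)%:R * f k.
Proof.
move=> /andP[a0 a1] f0 fS.
rewrite mulrC -ler_pdivlMr // mulrC.
have := @binomial_hole_le n d i a^-1 (fun k => f (n - k)%N).
rewrite (eq_bigr (fun k : 'I_n.+1 => 'C(n, k)%:R * f (n - k)%N)) //.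
have -> : \sum_(k < n.+1 | (i + k)%N%:Z != d) 'C(n, k)%:R * f (n - (n - k))%N =
   \sum_(k < n.+1 | (i + k)%N%:Z != d) 'C(n, k)%:R * f k.
  by apply: eq_bigr => k _; rewrite subKn // -ltnS.
apply=> //; first by rewrite invf_ge1.
move=> k kn; have -> : (n - k = (n - k.+1).+1)%N by lia.
have [|h1 h2] := fS (n - k.+1)%N; first lia.
by rewrite ![a^-1 * _]mulrC !ler_pdivlMr // ![_ * a]mulrC.
Qed.
End LevelInequalities.

(** * Means over the subsets of a given size *)

Section SubsetLevels.
Import fintype boot.finset.
Variables (R : realFieldType) (X : finType).
Implicit Types (D A B : {set X}) (f : {set X} -> R).

Definition level_mean D f (k : nat) : R :=
  (\sum_(A : {set X} | (A \subset D) && (#|A| == k)) f A) / 'C(#|D|, k)%:R.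

Lemma sum_subset_levels D (S : pred nat) f :
  \sum_(A : {set X} | (A \subset D) && S #|A|) f A =
  \sum_(k < #|D|.+1 | S k) 'C(#|D|, k)%:R * level_mean D f k.
Proof.
rewrite (partition_big (fun A : {set X} => inord #|A| : 'I_#|D|.+1) S) /=.
  apply: eq_bigr => k Sk; have kD : (k <= #|D|)%N by rewrite -ltnS.
  rewrite /level_mean mulrC divfK ?pnatr_eq0 -?lt0n ?bin_gt0 //.
  apply: eq_bigl => A; case: (boolP (A \subset D)) => //= AD.
  have cA : (#|A| < #|D|.+1)%N by rewrite ltnS subset_leq_card.
  rewrite -val_eqE /= inordK //.
  by case: eqP => [->|]; rewrite ?Sk ?andbF.
move=> A /andP[AD SA]; rewrite inordK // ltnS subset_leq_card //.
Qed.

(** Double counting of the pairs formed by a set and a marked element: removing the mark from [A]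
    gives [B], with the mark outside [B]. *)
Lemma exchange_subset_elt D (k : nat) (g : {set X} -> X -> R) :
  \sum_(A : {set X} | (A \subset D) && (#|A| == k.+1)) \sum_(e in A) g (A :\ e) e =
  \sum_(B : {set X} | (B \subset D) && (#|B| == k)) \sum_(e in D :\: B) g B e.
Proof.
rewrite (exchange_big_dep (mem D)) /=; last first.
  by move=> A e /andP[/subsetP AD _] /AD.
rewrite [RHS](exchange_big_dep (mem D)) /=; last first.
  by move=> A e _; rewrite inE => /andP[].
apply: eq_bigr => e eD.
rewrite (reindex_onto (fun B => e |: B) (fun A => A :\ e)) /=; last first.
  by move=> A /andP[_ eA]; rewrite setD1K.
apply: eq_big => [B|B /andP[_ /eqP->] //].
rewrite subUset sub1set eD setU11 /= inE eD !andbT.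
have [eB|eB] := boolP (e \in B).
  by rewrite !andbF; apply/negP => /andP[_ /eqP h]; rewrite -h !inE eqxx in eB.
by rewrite cardsU1 eB add1n eqSS setU1K // eqxx !andbT.
Qed.

(** This and [level_meanSE] express consecutive level means as sums over the same pairs [(B, e)]
    with the same normalisation, so that a bound for adding one element passes to the means term by
    term. *)
Lemma level_meanE D f (k : nat) : (k < #|D|)%N ->
  level_mean D f k =
  (\sum_(B : {set X} | (B \subset D) && (#|B| == k)) \sum_(e in D :\: B) f B)
  / ((#|D| - k)%:R * 'C(#|D|, k)%:R).
Proof.
move=> kD.
have -> : \sum_(B : {set X} | (B \subset D) && (#|B| == k)) \sum_(e in D :\: B) f B
   = (#|D| - k)%:R * \sum_(B : {set X} | (B \subset D) && (#|B| == k)) f B.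
  rewrite mulr_sumr; apply: eq_bigr => B /andP[BD /eqP Bk].
  by rewrite sumr_const cardsD (setIidPr BD) Bk mulr_natl.
rewrite -mulf_div divff ?mul1r // pnatr_eq0; lia.
Qed.

Lemma level_meanSE D f (k : nat) : (k < #|D|)%N ->
  level_mean D f k.+1 =
  (\sum_(B : {set X} | (B \subset D) && (#|B| == k)) \sum_(e in D :\: B) f (e |: B))
  / ((#|D| - k)%:R * 'C(#|D|, k)%:R).
Proof.
move=> kD.
rewrite -(exchange_subset_elt _ _ (fun B e => f (e |: B))) -natrM -mul_bin_left natrM.
rewrite (eq_bigr (fun A : {set X} => k.+1%:R * f A)); last first.
  move=> A /andP[AD /eqP Ak].
  rewrite (eq_bigr (fun _ => f A)) => [|e eA]; last by rewrite setD1K.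
  by rewrite sumr_const Ak mulr_natl.
by rewrite -mulr_sumr -mulf_div divff ?mul1r // pnatr_eq0.
Qed.

Lemma level_mean_ratio D f (a b : R) :
  (forall A e, A \subset D -> e \in D -> e \notin A ->
     a * f A <= f (e |: A) <= b * f A) ->
  forall k, (k < #|D|)%N ->
  a * level_mean D f k <= level_mean D f k.+1 <= b * level_mean D f k.
Proof.
move=> fab k kD; rewrite level_meanE // level_meanSE // !mulrA.
rewrite !ler_pM2r ?invr_gt0 -?natrM ?ltr0n ?muln_gt0 ?subn_gt0 ?kD ?bin_gt0 ?(ltnW kD) //.
rewrite !mulr_sumr; apply/andP; split; apply: ler_sum => B /andP[BD _];
  rewrite mulr_sumr; apply: ler_sum => e; rewrite inE => /andP[eB eD];
  by have /andP[] := fab B e BD eD eB.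
Qed.

(* [f k] stands for the mean of a function over the [k]-subsets of an [n]-set,
   so [f (n - k)] is its mean over their complements. *)
Definition level_ineq (S : pred nat) (a b x y : R) : Prop :=
  forall (n i : nat) (f : nat -> R), (forall k, 0 <= f k) ->
    (forall k, (k < n)%N -> a * f k <= f k.+1 <= b * f k) ->
    0 <= x * \sum_(k < n.+1 | S (i + k)%N) 'C(n, k)%:R * f (n - k)%N
       + y * \sum_(k < n.+1 | S (i + k)%N) 'C(n, k)%:R * f k.

(** The condition depends on [A] only through its size, so the sum depends on [f] only through its
    level means, and complementation sends level [k] to level [#|D| - k]. *)
Lemma subset_level_ineq (S : pred nat) (a b x y : R) D (i : nat) f :
  level_ineq S a b x y ->
  (forall A, 0 <= f A) ->
  (forall A e, A \subset D -> e \in D -> e \notin A ->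
     a * f A <= f (e |: A) <= b * f A) ->
  0 <= \sum_(A : {set X} | (A \subset D) && S (i + #|A|)%N)
         (x * f (D :\: A) + y * f A).
Proof.
move=> Sab f0 fab.
have := Sab #|D| i (level_mean D f) _ (level_mean_ratio fab).
rewrite big_split /= -!mulr_sumr.
rewrite (sum_subset_levels D (fun k => S (i + k)%N) f).
have -> : \sum_(A : {set X} | (A \subset D) && S (i + #|A|)%N) f (D :\: A) =
  \sum_(k < #|D|.+1 | S (i + k)%N) 'C(#|D|, k)%:R * level_mean D f (#|D| - k).
  rewrite (reindex_onto (fun A => D :\: A) (fun A => D :\: A)) /=; last first.
    by move=> A /andP[AD _]; rewrite setDDr setDv set0U; apply/setIidPr.
  rewrite [RHS](reindex_inj rev_ord_inj) /=.
  rewrite [LHS](eq_big (fun A => (A \subset D) && S (i + (#|D| - #|A|))%N) f).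
  - rewrite (sum_subset_levels D (fun k => S (i + (#|D| - k))%N)).
    apply: eq_big => [k|k _]; rewrite subSS // bin_sub ?subKn // -ltnS //.
  - move=> A; rewrite subsetDl setDDr setDv set0U.
    have [AD|AD] := boolP (A \subset D).
      by rewrite (setIidPr AD) eqxx andbT cardsD (setIidPr AD).
    apply/negbTE; move: AD; apply: contra => /andP[_ /eqP <-].
    exact: subsetIl.
  - move=> A /andP[_ /eqP ->] //.
apply=> k; rewrite divr_ge0 // sumr_ge0 //.
Qed.
End SubsetLevels.

(** * Product measures on subsets *)

Section BernoulliSubsets.
Import fintype boot.finset.
Variables (R : realFieldType) (X : finType) (p : X -> R).
Hypothesis p01 : forall e, 0 <= p e <= 1.
Implicit Types (g h Z A B D : {set X}).

Definition bern g : R := \prod_e (if e \in g then p e else 1 - p e).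

Lemma bern_ge0 g : 0 <= bern g.
Proof.
by apply: prodr_ge0 => e _; case: ifP => _; have /andP[] := p01 e; rewrite ?subr_ge0.
Qed.

Lemma sum_bern : \sum_g bern g = 1.
Proof. by rewrite -bigA_distr big1 // => e _ /=; ring. Qed.

(** Passing from [(g, h)] to [(mix Z g h, mix Z h g)] exchanges the coordinates of the pair on [Z],
    an involution on pairs. *)
Definition mix Z g h := (h :&: Z) :|: (g :\: Z).

Lemma bern_mix Z g h : bern (mix Z g h) * bern (mix Z h g) = bern g * bern h.
Proof.
rewrite -!big_split; apply: eq_bigr => e _ /=; rewrite !inE.
by case: (e \in Z); case: (e \in g); case: (e \in h) => //=; rewrite mulrC.
Qed.

Lemma sum_bern_swap Z (F : {set X} -> {set X} -> R) :
  \sum_g \sum_h bern g * bern h * F (mix Z g h) (mix Z h g) =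
  \sum_g \sum_h bern g * bern h * F g h.
Proof.
rewrite !pair_big /= [RHS](reindex_inj (h := fun gh => (mix Z gh.1 gh.2, mix Z gh.2 gh.1))) /=.
  by apply: eq_bigr => gh _; rewrite bern_mix.
apply: (can_inj (g := fun gh => (mix Z gh.1 gh.2, mix Z gh.2 gh.1))).
move=> [g h] /=; congr pair; apply/setP => e; rewrite !inE;
  by case: (e \in Z); case: (e \in g); case: (e \in h).
Qed.

Definition discrepancy B g h := B :&: ((g :\: h) :|: (h :\: g)).

(* Exchanging the coordinates of an independent pair on a uniformly random
   subset of those where they differ does not change the law of the pair. *)
Lemma sum_bern_ge0 B (F : {set X} -> {set X} -> R) :
  (forall g h, 0 <= \sum_(Z : {set X} | Z \subset discrepancy B g h)
                      F (mix Z g h) (mix Z h g)) ->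
  0 <= \sum_g \sum_h bern g * bern h * F g h.
Proof.
move=> F0; pose D := discrepancy B.
pose c g h : R := (2 ^ #|D g h|)%:R^-1.
have Dmix Z g h : D (mix Z g h) (mix Z h g) = D g h.
  apply/setP => e; rewrite !inE.
  by case: (e \in Z); case: (e \in g); case: (e \in h); case: (e \in B).
have -> : \sum_g \sum_h bern g * bern h * F g h =
  \sum_g \sum_h bern g * bern h * \sum_(Z : {set X} | Z \subset D g h)
     c g h * F (mix Z g h) (mix Z h g).
  (* With the sum over [Z] outermost, the exchange on each fixed [Z] is a change of variables. By
     [Dmix] it preserves the discrepancy, hence also the condition on [Z] and the normalisation
     [c]. *)
  transitivity (\sum_(Z : {set X}) \sum_g \sum_h bern g * bern h *
     ((Z \subset D g h)%:R * (c g h * F (mix Z g h) (mix Z h g)))).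
    transitivity (\sum_(Z : {set X}) \sum_g \sum_h bern g * bern h *
       ((Z \subset D g h)%:R * (c g h * F g h))); last first.
      apply: eq_bigr => Z _; rewrite -[LHS](sum_bern_swap Z).
      apply: eq_bigr => g _; apply: eq_bigr => h _.
      by rewrite /c !Dmix.
    rewrite [RHS]exchange_big; apply: eq_bigr => g _ /=.
    rewrite [RHS]exchange_big; apply: eq_bigr => h _ /=.
    rewrite -mulr_sumr; congr (_ * _).
    have cD : \sum_(Z : {set X}) (Z \subset D g h)%:R = (2 ^ #|D g h|)%:R :> R.
      rewrite -card_powerset -sum1_card natr_sum [RHS]big_mkcond.
      by apply: eq_bigr => Z _; rewrite powersetE; case: ifP.
    by rewrite -mulr_suml cD /c mulrA divff ?mul1r // pnatr_eq0 expn_eq0.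
  rewrite [LHS]exchange_big; apply: eq_bigr => g _ /=.
  rewrite [LHS]exchange_big; apply: eq_bigr => h _ /=.
  rewrite -mulr_sumr [in RHS]big_mkcond; congr (_ * _); apply: eq_bigr => Z _.
  by case: (Z \subset _); rewrite ?mul1r ?mul0r.
apply: sumr_ge0 => g _; apply: sumr_ge0 => h _.
rewrite -mulr_sumr !mulr_ge0 ?bern_ge0 ?invr_ge0 //; exact: F0.
Qed.

(** The product of the two means is a single mean over independent pairs, since replacing the trace
    of [g] on [B] by that of [h] makes [F] independent of the event. Averaging over exchanges inside
    [B] then reduces the claim to subsets of the discrepancy. *)
Lemma bern_level_ineq B (S : pred nat) (F : {set X} -> R) (a b x y : R) :
  level_ineq S a b x y ->
  (forall g, 0 <= F g) ->
  (forall g e, e \in B -> e \notin g -> a * F g <= F (e |: g) <= b * F g) ->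
  0 <= x * ((\sum_(g | S #|g :&: B|) bern g) * \sum_g bern g * F g)
       + y * \sum_(g | S #|g :&: B|) bern g * F g.
Proof.
move=> Sab F0 Fab.
pose I g : R := (S #|g :&: B|)%:R.
have iE (G : {set X} -> R) : \sum_(g | S #|g :&: B|) G g = \sum_g I g * G g.
  by rewrite big_mkcond; apply: eq_bigr => g _; rewrite /I; case: ifP; rewrite ?mul1r ?mul0r.
(* Exchanging outside [B] leaves the event of [g] unchanged and turns the argument [h] of [F] into
   [mix B g h]. *)
have E1 : (\sum_(g | S #|g :&: B|) bern g) * (\sum_g bern g * F g) =
    \sum_g \sum_h bern g * bern h * (I g * F (mix B g h)).
  have := sum_bern_swap (~: B) (fun g h => I g * F h).
  rewrite iE mulr_suml => /esym E; etransitivity; last (etransitivity; [exact: E|]).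
    apply: eq_bigr => g _; rewrite mulr_sumr; apply: eq_bigr => h _; ring.
  apply: eq_bigr => g _; apply: eq_bigr => h _; congr (_ * (_ * F _)); last first.
    apply/setP => e; rewrite !inE.
    by case: (e \in B); case: (e \in g); case: (e \in h).
  rewrite /I; congr (S #|pred_of_set _|)%:R; apply/setP => e; rewrite !inE.
  by case: (e \in B); case: (e \in g); case: (e \in h).
have E2 : \sum_(g | S #|g :&: B|) bern g * F g =
    \sum_g \sum_h bern g * bern h * (I g * F g).
  rewrite iE; apply: eq_bigr => g _; rewrite -mulr_suml -mulr_sumr sum_bern; ring.
rewrite E1 E2 !mulr_sumr -big_split /=.
rewrite (eq_bigr (fun g => \sum_h bern g * bern h *
   (I g * (x * F (mix B g h) + y * F g)))); last first.
  move=> g _; rewrite !mulr_sumr -big_split /=; apply: eq_bigr => h _; ring.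
apply: (@sum_bern_ge0 B
  (fun g h => I g * (x * F (mix B g h) + y * F g))) => g h; set D := discrepancy B g h.
(* For [A] inside [D], [t A] is the symmetric difference of [A] and [D :&: g]: exchanging on it
   leaves the first set with trace exactly [A] on [D]. As [g] and [h] are complementary on [D], the
   second set has trace [D :\: A]. *)
pose t A := (A :\: g) :|: ((D :&: g) :\: A).
have tD A : A \subset D -> t A \subset D.
  move=> /subsetP AD; apply/subsetP => e; have := AD e; rewrite !inE.
  by case: (e \in B); case: (e \in g); case: (e \in h); case: (e \in A) => //= ->.
have tK A : A \subset D -> t (t A) = A.
  move=> /subsetP AD; apply/setP => e; have := AD e; rewrite !inE.
  by case: (e \in B); case: (e \in g); case: (e \in h); case: (e \in A) => //= ->.
rewrite (reindex_onto t t) /=; last by move=> A; exact: tK.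
have tE A : A \subset D -> mix (t A) g h = (g :\: D) :|: A.
  move=> /subsetP AD; apply/setP => e; have := AD e; rewrite !inE.
  by case: (e \in B); case: (e \in g); case: (e \in h); case: (e \in A) => //= ->.
have tE' A : A \subset D -> mix B (mix (t A) g h) (mix (t A) h g) = (g :\: D) :|: (D :\: A).
  move=> /subsetP AD; apply/setP => e; have := AD e; rewrite !inE.
  by case: (e \in B); case: (e \in g); case: (e \in h); case: (e \in A) => //= ->.
have DB : D \subset B by exact: subsetIl.
have cE A : A \subset D -> #|((g :\: D) :|: A) :&: B| = (#|(g :\: D) :&: B| + #|A|)%N.
  move=> AD; rewrite setIUl (setIidPl (subset_trans AD DB)).
  apply/eqP; rewrite -cardsUI -[eqbLHS]addn0 eqn_add2l eq_sym cards_eq0.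
  rewrite setIC setIA -subset0; apply/subsetP => e; rewrite in_setI => /andP[].
  by rewrite in_setI in_setD => /andP[/(subsetP AD) -> //].
rewrite (eq_bigl (fun A => A \subset D)); last first.
  move=> A; apply/andP/idP => [[AD /eqP <-]|AD]; first exact: tD.
  by rewrite tD ?tK.
have := @subset_level_ineq _ _ S a b x y D #|(g :\: D) :&: B|
  (fun A => F ((g :\: D) :|: A)) Sab.
rewrite big_mkcondr /= => H.
rewrite (eq_bigr (fun A => if S (#|(g :\: D) :&: B| + #|A|)%N then
   x * F (g :\: D :|: (D :\: A)) + y * F (g :\: D :|: A) else 0)).
  apply: H => // A e AD eD eA; rewrite setUCA; apply: Fab.
    exact: (subsetP DB).
  by rewrite in_setU in_setD eD /= (negbTE eA).
move=> A AD; rewrite tE' // tE // /I cE //.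
by case: ifP; rewrite ?mul1r ?mul0r.
Qed.
End BernoulliSubsets.

(** * Exponential moments and tail bounds *)

Section DerivativeSigns.
Variable R : realType.
Implicit Types (f g df : R -> R) (a b x k : R).

Lemma is_derive1D f g x a b : is_derive x 1 f a -> is_derive x 1 g b ->
  is_derive x 1 (fun y => f y + g y) (a + b).
Proof. exact: is_deriveD. Qed.

Lemma is_derive1Zl f x a k : is_derive x 1 f a ->
  is_derive x 1 (fun y => k * f y) (k * a).
Proof. exact: is_deriveZ. Qed.

Lemma is_derive1M f g x a b : is_derive x 1 f a -> is_derive x 1 g b ->
  is_derive x 1 (fun y => f y * g y) (f x * b + g x * a).
Proof. exact: is_deriveM. Qed.

Lemma is_derive1_expR f x a : is_derive x 1 f a ->
  is_derive x 1 (fun y => expR (f y)) (expR (f x) * a).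
Proof. by move=> fa; apply: (is_derive1_comp (f := expR)). Qed.

Lemma is_derive1_sum (I : finType) (f : I -> R -> R) (df : I -> R) x :
  (forall i, is_derive x 1 (f i) (df i)) ->
  is_derive x 1 (fun y => \sum_i f i y) (\sum_i df i).
Proof.
move=> fd; rewrite -(fct_sumE _ xpredT f).
by elim/big_ind2 : _ => // [|] *; [exact: is_derive_cst|exact: is_deriveD].
Qed.

Lemma derive_ge0_le f df a b : a <= b ->
  (forall x, is_derive x 1 f (df x)) -> (forall x, a <= x <= b -> 0 <= df x) ->
  f a <= f b.
Proof.
move=> ab fd df0.
have [|x xab e] := @MVT_segment R f df a b ab (fun x _ => fd x).
  by apply: derivable_within_continuous => x _; have := fd x; case.
by rewrite -subr_ge0 e mulr_ge0 ?subr_ge0 // df0.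
Qed.

Lemma derive_le0_ge f df a b : a <= b ->
  (forall x, is_derive x 1 f (df x)) -> (forall x, a <= x <= b -> df x <= 0) ->
  f b <= f a.
Proof.
move=> ab fd df0; rewrite -lerN2.
apply: (@derive_ge0_le (fun x => - f x) (fun x => - df x)) => // x /df0.
by rewrite oppr_ge0.
Qed.

(** The function [expR y - y - y ^+ 2 / 2] has derivative [expR y - 1 - y >= 0], so its value at
    [x <= 0] is at most its value at [0]. *)
Lemma expR_le_quadratic x : x <= 0 -> expR x <= 1 + x + x ^+ 2 / 2.
Proof.
move=> x0; pose f y : R := expR y + (-1 * y + (- 2^-1 * (y * y))).
suff : f x <= f 0 by rewrite /f expR0 expr2; lra.
pose df y : R := expR y * 1 + (-1 * 1 + - 2^-1 * (y * 1 + y * 1)).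
have fd (y : R) : is_derive y 1 f (df y).
  have dy := is_derive_id y (1 : R).
  exact: (is_derive1D (is_derive1_expR dy)
    (is_derive1D (is_derive1Zl _ dy) (is_derive1Zl _ (is_derive1M dy dy)))).
apply: (derive_ge0_le x0 fd) => y _.
by rewrite /df; have := expR_ge1Dx y; lra.
Qed.

(** Multiplying by [1 - x / 3 > 0] turns the claim into [0 <= f x]. Here [f] and its derivative [g]
    vanish at [0], and [g' = (1 - (1 - y) * expR y) / 3 >= 0] because [1 - y <= expR (- y)]. *)
Lemma expR_bernstein x : 0 <= x < 3 ->
  expR x <= 1 + x + x ^+ 2 / (2 * (1 - x / 3)).
Proof.
move=> /andP[x0 x3].
pose g y : R := 2 / 3 + (3^-1 * y + expR y * (- (2 / 3) + 3^-1 * y)).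
pose dg y : R := 0 + (3^-1 * 1 +
     (expR y * (0 + 3^-1 * 1) + (- (2 / 3) + 3^-1 * y) * (expR y * 1))).
have gd (y : R) : is_derive y 1 g (dg y).
  have dy := is_derive_id y (1 : R).
  have dc c := is_derive_cst (c : R) y (1 : R).
  exact: (is_derive1D (dc _) (is_derive1D (is_derive1Zl _ dy)
    (is_derive1M (is_derive1_expR dy) (is_derive1D (dc _) (is_derive1Zl _ dy))))).
have g0 y : 0 <= y -> 0 <= g y.
  move=> y0; have -> : 0 = g 0 by rewrite /g expR0; lra.
  apply: (derive_ge0_le y0 gd) => z _; rewrite /dg.
  have : (1 - z) * expR z <= 1.
    rewrite -(@ler_pM2r _ (expR (- z))) ?expR_gt0 // -mulrA -expRD subrr expR0.
    by rewrite mulr1 mul1r; exact: expR_ge1Dx.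
  lra.
pose f y : R := 1 + (2 / 3 * y + (6^-1 * (y * y) + expR y * (-1 + 3^-1 * y))).
pose df y : R := 0 + (2 / 3 * 1 + (6^-1 * (y * 1 + y * 1) +
     (expR y * (0 + 3^-1 * 1) + (-1 + 3^-1 * y) * (expR y * 1)))).
have fd (y : R) : is_derive y 1 f (df y).
  have dy := is_derive_id y (1 : R).
  have dc c := is_derive_cst (c : R) y (1 : R).
  exact: (is_derive1D (dc _) (is_derive1D (is_derive1Zl _ dy)
    (is_derive1D (is_derive1Zl _ (is_derive1M dy dy))
      (is_derive1M (is_derive1_expR dy) (is_derive1D (dc _) (is_derive1Zl _ dy)))))).
have f0 : 0 <= f x.
  have -> : 0 = f 0 by rewrite /f expR0; lra.
  apply: (derive_ge0_le x0 fd) => y /andP[y0 _].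
  by have := g0 y y0; rewrite /g /df; lra.
rewrite -lerBlDl ler_pdivlMr; last lra.
move: f0; rewrite /f expr2; lra.
Qed.

End DerivativeSigns.

(* [m' <= mu e^(c s) m] for [s >= 0], with the reverse inequality for [s <= 0],
   says that [s |-> m s * exp (- mu / c * e^(c s))] is maximal at [0]. *)
Lemma mgf_le (R : realType) (I : finType) (W Y : I -> R) (mu c : R) : 0 < c ->
  \sum_i W i = 1 ->
  (forall s : R, 0 <= s -> \sum_i W i * (Y i * expR (Y i * s)) <=
     mu * expR (c * s) * \sum_i W i * expR (Y i * s)) ->
  (forall s : R, s <= 0 -> mu * expR (c * s) * \sum_i W i * expR (Y i * s) <=
     \sum_i W i * (Y i * expR (Y i * s))) ->
  forall s : R, \sum_i W i * expR (Y i * s) <= expR (mu / c * (expR (c * s) - 1)).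
Proof.
move=> c0 W1 Hp Hn s.
pose q t := \sum_i W i * expR (Y i * t + - (mu / c) * expR (c * t)).
pose dq t := \sum_i W i * (expR (Y i * t + - (mu / c) * expR (c * t)) *
   (Y i * 1 + - (mu / c) * (expR (c * t) * (c * 1)))).
have qd (t : R) : is_derive t 1 q (dq t).
  exact: is_derive1_sum.
have qE t : q t = expR (- (mu / c) * expR (c * t)) * \sum_i W i * expR (Y i * t).
  by rewrite mulr_sumr; apply: eq_bigr => i _; rewrite expRD; ring.
have dqE t : dq t = expR (- (mu / c) * expR (c * t)) *
   (\sum_i W i * (Y i * expR (Y i * t)) -
    mu * expR (c * t) * \sum_i W i * expR (Y i * t)).
  rewrite mulrBr !mulr_sumr -sumrB; apply: eq_bigr => i _; rewrite expRD.
  by field; rewrite gt_eqF.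
have q0 : q s <= q 0.
  have [s0|/ltW s0] := leP 0 s.
    apply: (derive_le0_ge s0 qd) => t /andP[t0 _].
    by rewrite dqE mulr_ge0_le0 ?expR_ge0 // subr_le0; exact: Hp.
  apply: (derive_ge0_le s0 qd) => t /andP[_ t0].
  by rewrite dqE mulr_ge0 ?expR_ge0 // subr_ge0; exact: Hn.
have : q 0 = expR (- (mu / c)).
  rewrite qE mulr0 expR0 mulr1 (eq_bigr W) ?W1 ?mulr1 // => i _.
  by rewrite mulr0 expR0 mulr1.
move: q0; rewrite qE => /[swap] -> h.
rewrite -(@ler_pM2l _ (expR (- (mu / c) * expR (c * s)))) ?expR_gt0 //.
apply: le_trans h _; rewrite -expRD.
by rewrite ler_expR; lra.
Qed.

(** * Chernoff bounds: from a family of exponential bounds to the five inequalities *)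

Section Chernoff.
Variables (R : realType) (d : measure_display) (T : measurableType d).
Variables (P : probability T R) (Y : T -> R) (mu c : R).
Hypotheses (mu0 : 0 < mu) (c0 : 0 < c).
Hypothesis upper : forall s t : R, 0 <= s ->
  (P [set x | (t <= Y x - mu)%R]%classic
   <= (expR (mu / c * (expR (c * s) - 1) - s * (mu + t)))%:E)%E.
Hypothesis lower : forall s t : R, s <= 0 ->
  (P [set x | (Y x - mu <= t)%R]%classic
   <= (expR (mu / c * (expR (c * s) - 1) - s * (mu + t)))%:E)%E.

Let nz : (mu != 0) * (c != 0).
Proof. by rewrite !gt_eqF. Qed.

(** The exponent is stationary in [s] where [mu * expR (c * s) = mu + t]; this is its value at that
    point. The optimal [s] has the sign of [t], as [upper] and [lower] require. *)
Let poissonE (t : R) : - mu < t ->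
  poisson_bound mu c t = expR (mu / c * (expR (c * (ln ((mu + t) / mu) / c)) - 1)
    - ln ((mu + t) / mu) / c * (mu + t)).
Proof.
move=> tmu; have mt : 0 < mu + t by lra.
rewrite /poisson_bound gt_eqF // /powR ?gt_eqF ?divr_gt0 // -expRD.
rewrite [c * _]mulrC divfK ?nz // lnK ?posrE ?divr_gt0 //.
rewrite -[mu / (mu + t)]invf_div lnV ?posrE ?divr_gt0 //; congr expR.
field; by rewrite !nz.
Qed.

Lemma upper_poisson_bound (t : R) : 0 <= t ->
  (P [set x | (t <= Y x - mu)%R]%classic <= (poisson_bound mu c t)%:E)%E.
Proof.
move=> t0; have m0 := mu0; rewrite poissonE; last lra.
apply: upper; rewrite divr_ge0 ?ln_ge0 ?ler_pdivlMr ?mul1r ?(ltW c0) //; lra.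
Qed.

Lemma lower_poisson_bound (t : R) : - mu <= t <= 0 ->
  (P [set x | (Y x - mu <= t)%R]%classic <= (poisson_bound mu c t)%:E)%E.
Proof.
have m0 := mu0; rewrite le_eqVlt => /andP[/predU1P[<- _|mt t0]]; last first.
  rewrite poissonE //; apply: lower.
  rewrite mulr_le0_ge0 ?invr_ge0 ?(ltW c0) // -ln1 ler_ln ?posrE ?ltr01 ?divr_gt0 //; last lra.
  by rewrite ler_pdivrMr // mul1r; lra.
(* At [t = - mu] the infimum is approached only as [s] tends to minus infinity. With
   [k = expR (c * s)], the bound is [expR (mu / c * (k - 1))] for [0 < k <= 1], and [k] is taken
   small enough to lose at most [e] in the exponent. *)
rewrite /poisson_bound eqxx.
set A := [set _ | _]%classic.
have Ps s : s <= 0 -> (P A <= (expR (mu / c * (expR (c * s) - 1)))%:E)%E.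
  by move=> s0; have := lower (- mu) s0; rewrite subrr mulr0 subr0.
have [v Pv] : exists v, P A = v%:E.
  have : (0 <= P A)%E by [].
  have := Ps 0 (lexx _).
  by case: (P A) => [v _ _| |]; [exists v| |].
rewrite Pv lee_fin.
have [v0|v0] := leP v 0; first by rewrite (le_trans v0) ?expR_ge0.
rewrite -[v]lnK ?posrE // ler_expR.
apply/ler_addgt0Pr => e e0.
pose k := Num.min 1 (e / (mu / c)).
have mc0 : 0 < mu / c by rewrite divr_gt0.
have k0 : 0 < k by rewrite lt_min ltr01 divr_gt0.
have /Ps : ln k / c <= 0.
  by rewrite mulr_le0_ge0 ?invr_ge0 ?(ltW c0) // -ln1 ler_ln ?posrE ?ltr01 // ge_min lexx.
rewrite [c * _]mulrC divfK ?nz // lnK ?posrE // Pv lee_fin -ler_expR => h.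
have : k * (mu / c) <= e by rewrite -ler_pdivlMr // ge_min lexx orbT.
move: h; rewrite -{1}[v]lnK ?posrE // !ler_expR; lra.
Qed.

(** The choice [s = - t / (c * mu)] minimises the exponent once [expR (c * s)] is replaced by its
    quadratic upper bound. *)
Lemma lower_gauss_bound (t : R) : 0 < t ->
  (P [set x | (Y x - mu <= - t)%R]%classic
   <= (expR (- (t ^+ 2 / (2 * c * mu))))%:E)%E.
Proof.
move=> t0; have m0 := mu0; pose u := t / mu; have u0 : 0 < u by rewrite divr_gt0.
have /lower/le_trans : - u / c <= 0 by rewrite mulNr oppr_le0 divr_ge0 ?ltW.
apply; rewrite lee_fin ler_expR [c * _]mulrC divfK ?nz //.
have : expR (- u) <= 1 + - u + (- u) ^+ 2 / 2.
  by apply: expR_le_quadratic; rewrite oppr_le0 ltW.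
move=> h; have -> : - (t ^+ 2 / (2 * c * mu)) =
  mu / c * (- u + (- u) ^+ 2 / 2) - - u / c * (mu - t).
  by rewrite /u; field; rewrite !nz.
by rewrite lerD2r ler_pM2l ?divr_gt0 //; lra.
Qed.

(* The exponent is optimised up to the Bernstein estimate of [expR], at
   [c * s = u / (1 + u / 3)] with [u = t / mu]. *)
Lemma upper_bernstein_bound (t : R) : 0 < t ->
  (P [set x | (t <= Y x - mu)%R]%classic
   <= (expR (- (t ^+ 2 / (2 * c * mu + 2 * c * t / 3))))%:E)%E.
Proof.
move=> t0; have m0 := mu0; pose x := 3 * t / (3 * mu + t).
have mt : 0 < 3 * mu + t by lra.
have x0 : 0 < x by rewrite divr_gt0 ?mulr_gt0.
have x3 : x < 3 by rewrite ltr_pdivrMr //; lra.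
have /upper/le_trans : 0 <= x / c by rewrite divr_ge0 ?ltW.
apply; rewrite lee_fin ler_expR [c * _]mulrC divfK ?nz //.
have : expR x <= 1 + x + x ^+ 2 / (2 * (1 - x / 3)).
  by apply: expR_bernstein; rewrite x3 ltW.
move=> h.
have -> : - (t ^+ 2 / (2 * c * mu + 2 * c * t / 3)) =
  mu / c * (x + x ^+ 2 / (2 * (1 - x / 3))) - x / c * (mu + t).
  rewrite /x; field; rewrite nz addrK mulf_neq0 ?nz ?pnatr_eq0 //=.
  have -> : 2 * c * mu * 3 + 2 * c * t = 2 * c * (3 * mu + t) by ring.
  by rewrite !mulf_neq0 ?nz ?pnatr_eq0 ?(gt_eqF mt).
by rewrite lerD2r ler_pM2l ?divr_gt0 //; lra.
Qed.

Lemma upper_gauss_bound (t : R) : 0 < t ->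
  (P [set x | (t <= Y x - mu)%R]%classic
   <= (expR (- (t ^+ 2 / (2 * c * mu + c * t))))%:E)%E.
Proof.
move=> t0; apply: le_trans (upper_bernstein_bound t0) _.
have h1 : 0 < c * mu by rewrite mulr_gt0.
have h2 : 0 < c * t by rewrite mulr_gt0.
rewrite lee_fin ler_expR lerN2 ler_wpM2l ?sqr_ge0 //.
rewrite lef_pV2 ?posrE; lra.
Qed.

Lemma chernoff_concentrated : concentrated P Y mu c.
Proof.
split; [exact: lower_gauss_bound | exact: upper_gauss_bound |
  exact: upper_poisson_bound | exact: lower_poisson_bound |
  exact: upper_bernstein_bound].
Qed.
End Chernoff.

(** * Size bias of degree indicators *)

Section Degrees.
Import fintype boot.finset.
Variable m : nat.
Implicit Types (a b : 'I_m) (e : {set 'I_m}) (g : {set {set 'I_m}}).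

Definition star a : {set {set 'I_m}} := [set [set a; b] | b in [set~ a]].

Lemma edge_inj a : {in [set~ a] &, injective (fun b => [set a; b])}.
Proof.
move=> b b'; rewrite !inE => /negbTE ba _ /setP/(_ b).
by rewrite !inE eqxx ba orbT /= => /esym/eqP.
Qed.

Lemma in_star a e : (e \in star a) = (e \in edges m) && (a \in e).
Proof.
apply/imsetP/andP => [[b]|[]].
  by rewrite !inE => ba ->; rewrite cards2 (eq_sym a) ba !inE eqxx.
rewrite inE => /cards2P[b [b' [bb' ->]]]; rewrite !inE => /orP[] /eqP ->.
  by exists b'; rewrite ?inE // eq_sym.
by exists b; rewrite ?inE // setUC.
Qed.

(** The form in which a condition on the degree is a condition on the trace size, as in
    [bern_level_ineq] with [B = star a]. *)
Lemma degreeE g a : degree g a = #|g :&: star a|.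
Proof.
rewrite /degree -(card_in_imset (f := fun b => [set a; b])).
  apply: eq_card => e; rewrite inE; apply/imsetP/andP => [[b]|[eg /imsetP[b ba eE]]].
    by rewrite inE => /andP[ba bg] ->; split=> //; apply: imset_f; rewrite !inE.
  by exists b; rewrite // inE -eE eg; move: ba; rewrite !inE => ->.
by move=> b b'; rewrite !inE => /andP[ba _] /andP[ba' _]; apply: edge_inj; rewrite !inE.
Qed.

Lemma degreeU1 g e b : e \in edges m -> e \notin g ->
  degree (e |: g) b = (degree g b + (b \in e))%N.
Proof.
move=> eE eg; rewrite !degreeE setIUl; have [be|be] := boolP (b \in e).
  have -> : [set e] :&: star b = [set e].
    by apply/setIidPl; rewrite sub1set in_star eE.
  by rewrite cardsU1 !inE (negbTE eg) /= addnC.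
have -> : [set e] :&: star b = set0.
  apply/setP => e'; rewrite in_setI in_set1 in_set0 in_star.
  by case: eqP => // ->; rewrite (negbTE be) andbF.
by rewrite set0U addn0.
Qed.

Variables (R : realType) (w : 'I_m -> R) (S : 'I_m -> pred nat).

Definition degree_stat g : R := \sum_b w b * (S b (degree g b))%:R.

Definition degree_stat_off a g : R :=
  \sum_(b | b != a) w b * (S b (degree g b))%:R.

Lemma degree_statE a g : degree_stat g =
  w a * (S a (degree g a))%:R + degree_stat_off a g.
Proof. by rewrite /degree_stat (bigD1 a). Qed.

(** With the summand of [a] left out, a new edge at [a] affects only the summand of its other
    endpoint. *)
Lemma degree_stat_offU1 a b g : b != a -> [set a; b] \notin g ->
  degree_stat_off a ([set a; b] |: g) - degree_stat_off a g =
  w b * ((S b (degree g b).+1)%:R - (S b (degree g b))%:R).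
Proof.
move=> ba eg; have eE : [set a; b] \in edges m by rewrite inE cards2 (eq_sym a) ba.
rewrite /degree_stat_off (bigD1 b) //= [X in _ - X](bigD1 b) //=.
rewrite degreeU1 // !inE eqxx orbT addn1.
rewrite (eq_bigr (fun i => w i * (S i (degree g i))%:R)).
  by set X := \sum_(_ | _) _; ring.
move=> i /andP[ia ib]; rewrite degreeU1 // !inE (negbTE ia) (negbTE ib).
by rewrite addn0.
Qed.

Variables (p : {set 'I_m} -> R) (wm c : R).
Hypothesis p01 : forall e, 0 <= p e <= 1.
Hypothesis w0 : forall a, 0 < w a.
Hypothesis w_le : forall a, w a <= wm.

Let F a s g := expR (degree_stat_off a g * s).

(* The conditional law given [S a (degree g a)] as a size biasing: [k] bounds
   the change of the other summands. *)
Definition tilt_bound a (k : R) : Prop :=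
  (forall s : R, 0 <= s ->
    \sum_(g | S a (degree g a)) bern p g * F a s g <=
    expR (k * s) * ((\sum_(g | S a (degree g a)) bern p g) *
                    \sum_g bern p g * F a s g)) /\
  (forall s : R, s <= 0 ->
    expR (k * s) * ((\sum_(g | S a (degree g a)) bern p g) *
                    \sum_g bern p g * F a s g) <=
    \sum_(g | S a (degree g a)) bern p g * F a s g).

Lemma tilt_ratio a (lo hi s : R) :
  (forall b g, b != a ->
     lo <= w b * ((S b (degree g b).+1)%:R - (S b (degree g b))%:R) * s <= hi) ->
  forall g e, e \in star a -> e \notin g ->
  expR lo * F a s g <= F a s (e |: g) <= expR hi * F a s g.
Proof.
move=> lohi g e /imsetP[b]; rewrite !inE => ba -> abg.
have := lohi b g ba; rewrite -(degree_stat_offU1 ba abg) mulrBl => /andP[h1 h2].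
by rewrite /F -!expRD !ler_expR; apply/andP; split; lra.
Qed.

Lemma tilt_level a (lo hi s x y : R) :
  (forall b g, b != a ->
     lo <= w b * ((S b (degree g b).+1)%:R - (S b (degree g b))%:R) * s <= hi) ->
  level_ineq (S a) (expR lo) (expR hi) x y ->
  0 <= x * ((\sum_(g | S a (degree g a)) bern p g) * \sum_g bern p g * F a s g)
       + y * \sum_(g | S a (degree g a)) bern p g * F a s g.
Proof.
move=> /tilt_ratio lohi SL.
have sE (f : {set {set 'I_m}} -> R) :
    \sum_(g | S a (degree g a)) f g = \sum_(g | S a #|g :&: star a|) f g.
  by apply: eq_bigl => g; rewrite degreeE.
rewrite !sE; apply: (bern_level_ineq p01 SL _ lohi) => g; exact: expR_ge0.
Qed.

(** On the event at [a] the own summand equals [w a], giving the factor [expR (w a * s)]. In the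
    unconditioned moment, [degree_stat_off a <= degree_stat] allows the own summand to be restored,
    in the direction fitting the sign of [s]. *)
Lemma tilt_bound_size_bias a (k s : R) : tilt_bound a k -> w a + k <= c ->
  (0 <= s -> \sum_(g | S a (degree g a)) bern p g * expR (degree_stat g * s) <=
   expR (c * s) * ((\sum_(g | S a (degree g a)) bern p g) *
                    \sum_g bern p g * expR (degree_stat g * s))) /\
  (s <= 0 -> expR (c * s) * ((\sum_(g | S a (degree g a)) bern p g) *
                    \sum_g bern p g * expR (degree_stat g * s)) <=
   \sum_(g | S a (degree g a)) bern p g * expR (degree_stat g * s)).
Proof.
move=> [tp tn] kc.
have W0 := bern_ge0 p01.
have -> : \sum_(g | S a (degree g a)) bern p g * expR (degree_stat g * s) =
    expR (w a * s) * \sum_(g | S a (degree g a)) bern p g * F a s g.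
  rewrite mulr_sumr; apply: eq_bigr => g Sg.
  by rewrite (degree_statE a) Sg mulr1 mulrDl expRD mulrCA.
have PA0 : 0 <= \sum_(g | S a (degree g a)) bern p g by exact: sumr_ge0.
have M0 : 0 <= \sum_g bern p g * expR (degree_stat g * s).
  by apply: sumr_ge0 => g _; rewrite mulr_ge0 ?expR_ge0.
have H0 g : degree_stat_off a g <= degree_stat g.
  by rewrite (degree_statE a) lerDr mulr_ge0 // ltW.
split=> s0.
  apply: (@le_trans _ _ (expR (w a * s) * (expR (k * s) *
    ((\sum_(g | S a (degree g a)) bern p g) *
      \sum_g bern p g * expR (degree_stat g * s))))).
    rewrite ler_pM2l ?expR_gt0 //; apply: le_trans (tp s s0) _.
    rewrite ler_pM2l ?expR_gt0 // ler_wpM2l //; apply: ler_sum => g _.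
    by rewrite ler_wpM2l // ler_expR ler_wpM2r.
  by rewrite mulrA -expRD ler_wpM2r ?mulr_ge0 // ler_expR -mulrDl ler_wpM2r.
apply: (@le_trans _ _ (expR (w a * s) * (expR (k * s) *
    ((\sum_(g | S a (degree g a)) bern p g) *
      \sum_g bern p g * expR (degree_stat g * s))))).
  by rewrite mulrA -expRD ler_wpM2r ?mulr_ge0 // ler_expR -mulrDl ler_wnM2r.
rewrite ler_pM2l ?expR_gt0 //; apply: le_trans (tn s s0).
rewrite ler_pM2l ?expR_gt0 // ler_wpM2l //; apply: ler_sum => g _.
by rewrite ler_wpM2l // ler_expR ler_wnM2r.
Qed.

Definition degree_mean : R :=
  \sum_a w a * \sum_(g | S a (degree g a)) bern p g.

Lemma degree_stat_mgf_le (s : R) : 0 < c ->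
  (forall a, exists2 k, tilt_bound a k & w a + k <= c) ->
  \sum_g bern p g * expR (degree_stat g * s) <=
  expR (degree_mean / c * (expR (c * s) - 1)).
Proof.
move=> c0 tb.
(* Expanding the factor [degree_stat g] expresses the derivative of the moment generating function
   through the moments restricted to the events at the vertices. *)
have swap t : \sum_g bern p g * (degree_stat g * expR (degree_stat g * t)) =
   \sum_a w a * \sum_(g | S a (degree g a)) bern p g * expR (degree_stat g * t).
  rewrite (eq_bigr (fun g => \sum_a w a * ((S a (degree g a))%:R *
      (bern p g * expR (degree_stat g * t))))).
    rewrite exchange_big; apply: eq_bigr => a _; rewrite -mulr_sumr; congr (_ * _).
    by rewrite [RHS]big_mkcond; apply: eq_bigr => g _; case: ifP; rewrite ?mul1r ?mul0r.
  move=> g _; rewrite mulrCA {1}/degree_stat mulr_suml; apply: eq_bigr => a _; ring.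
have mean t : degree_mean * expR (c * t) *
    (\sum_g bern p g * expR (degree_stat g * t)) =
   \sum_a w a * (expR (c * t) * ((\sum_(g | S a (degree g a)) bern p g) *
      \sum_g bern p g * expR (degree_stat g * t))).
  by rewrite /degree_mean !mulr_suml; apply: eq_bigr => a _; ring.
apply: mgf_le => // [|t t0|t t0]; first exact: sum_bern.
  rewrite swap mean; apply: ler_sum => a _; have [k tk kc] := tb a.
  have [h _] := tilt_bound_size_bias t tk kc.
  by rewrite ler_wpM2l ?(ltW (w0 a)) // h.
rewrite swap mean; apply: ler_sum => a _; have [k tk kc] := tb a.
have [_ h] := tilt_bound_size_bias t tk kc.
by rewrite ler_wpM2l ?(ltW (w0 a)) // h.
Qed.

(** A new edge raises the other summands by at most [wm] and never lowers them, so the ratio of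
    consecutive levels lies between [1] and [expR (wm * s)]; the tail inequalities lose [d a] such
    factors. *)
Lemma tilt_bound_ge a (d : 'I_m -> nat) :
  (forall b n, S b n = (d b <= n)%N) -> tilt_bound a (wm * (d a)%:R).
Proof.
move=> SE; have wm0 : 0 <= wm by apply: le_trans (w_le a); exact: ltW.
have incr b n : 0 <= w b * ((S b n.+1)%:R - (S b n)%:R) <= wm.
  have /andP[i0 i1] : 0 <= ((S b n.+1)%:R - (S b n)%:R : R) <= 1.
    rewrite !SE; case: (leqP (d b) n) => dn.
      by rewrite (leq_trans dn) // subrr lexx ler01.
    by case: (_ <= _)%N; rewrite subr0 ?lexx ler01.
  by rewrite mulr_ge0 ?(ltW (w0 b)) //= (le_trans _ (w_le b)) // ler_piMr // ltW.
have expE s : expR (wm * (d a)%:R * s) = expR (wm * s) ^+ d a.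
  by rewrite -expRM_natl; congr expR; ring.
have sum_eq n i (f : nat -> R) : \sum_(k < n.+1 | S a (i + k)%N) f k =
    \sum_(k < n.+1 | (d a <= i + k)%N) f k.
  by apply: eq_bigl => k; rewrite SE.
split=> s s0; rewrite expE.
  rewrite -subr_ge0 -mulN1r; apply: (@tilt_level a 0 (wm * s)).
    move=> b g _; have /andP[i0 i1] := incr b (degree g b).
    by rewrite mulr_ge0 //= ler_wpM2r.
  rewrite expR0 => n i f f0 fS; rewrite mulN1r subr_ge0.
  rewrite (sum_eq _ _ (fun k => 'C(n, k)%:R * f k)).
  rewrite (sum_eq _ _ (fun k => 'C(n, k)%:R * f (n - k)%N)).
  apply: binomial_tail_le => //; first by rewrite -expR0 ler_expR mulr_ge0.
  by move=> k /fS; rewrite mul1r.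
rewrite -subr_ge0 addrC -mulNr -[X in _ + X]mul1r.
apply: (@tilt_level a (wm * s) 0).
  move=> b g _; have /andP[i0 i1] := incr b (degree g b).
  by rewrite mulr_ge0_le0 // ler_wnM2r.
rewrite expR0 => n i f f0 fS; rewrite mul1r mulNr addrC subr_ge0.
rewrite (sum_eq _ _ (fun k => 'C(n, k)%:R * f k)).
rewrite (sum_eq _ _ (fun k => 'C(n, k)%:R * f (n - k)%N)).
apply: binomial_tail_ge => //.
  by rewrite expR_gt0 -expR0 ler_expR mulr_ge0_le0.
by move=> k /fS; rewrite mul1r.
Qed.

(** A new edge may now raise or lower a summand, by at most [wm]. Only one level is excluded, and
    the hole inequalities lose a single factor [expR (wm * s)], whatever the value of [d a]. *)
Lemma tilt_bound_ne a (d : 'I_m -> int) :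
  (forall b n, S b n = (n%:Z != d b)) -> tilt_bound a wm.
Proof.
move=> SE; have wm0 : 0 <= wm by apply: le_trans (w_le a); exact: ltW.
have incr b n : - wm <= w b * ((S b n.+1)%:R - (S b n)%:R) <= wm.
  have : - 1 <= ((S b n.+1)%:R - (S b n)%:R : R) <= 1.
    by case: (S b n.+1); case: (S b n); rewrite /= ?mulr1n ?mulr0n; lra.
  rewrite -!ler_norml => i1; rewrite normrM (gtr0_norm (w0 b)).
  by rewrite (le_trans _ (w_le b)) // ler_piMr // ltW.
have sum_eq n i (f : nat -> R) : \sum_(k < n.+1 | S a (i + k)%N) f k =
    \sum_(k < n.+1 | (i + k)%N%:Z != d a) f k.
  by apply: eq_bigl => k; rewrite SE.
split=> s s0.
  rewrite -subr_ge0 -mulN1r; apply: (@tilt_level a (- (wm * s)) (wm * s)).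
    move=> b g _; have /andP[i0 i1] := incr b (degree g b).
    by rewrite -mulNr !ler_wpM2r.
  move=> n i f f0 fS; rewrite mulN1r subr_ge0.
  rewrite (sum_eq _ _ (fun k => 'C(n, k)%:R * f k)).
  rewrite (sum_eq _ _ (fun k => 'C(n, k)%:R * f (n - k)%N)).
  apply: binomial_hole_le => //; first by rewrite -expR0 ler_expR mulr_ge0.
  move=> k /fS /andP[h1 h2]; split=> //.
  by rewrite -ler_pdivrMl ?expR_gt0 // -expRN.
rewrite -subr_ge0 addrC -mulNr -[X in _ + X]mul1r.
apply: (@tilt_level a (wm * s) (- (wm * s))).
  move=> b g _; have /andP[i0 i1] := incr b (degree g b).
  by rewrite -mulNr !ler_wnM2r.
move=> n i f f0 fS; rewrite mul1r mulNr addrC subr_ge0.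
rewrite (sum_eq _ _ (fun k => 'C(n, k)%:R * f k)).
rewrite (sum_eq _ _ (fun k => 'C(n, k)%:R * f (n - k)%N)).
apply: binomial_hole_ge => //.
  by rewrite expR_gt0 -expR0 ler_expR mulr_ge0_le0.
move=> k /fS /andP[h1 h2]; split=> //.
by rewrite mulrC -ler_pdivlMr ?expR_gt0 // mulrC -expRN.
Qed.
End Degrees.

(** * The law of the random graph *)

Section FiniteValued.
Variables (R : realType) (d : measure_display) (T : measurableType d).
Variables (P : probability T R) (I : finType) (N : T -> I).
Hypothesis mN : forall i, measurable [set x | N x = i]%classic.

Lemma measurable_finite_valued (Q : pred I) : measurable [set x | Q (N x)]%classic.
Proof.
have -> : [set x | Q (N x)]%classic =
    (\bigcup_(i in [set` Q]) [set x | N x = i])%classic.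
  apply/seteqP; split => [x Qx|x [i /= Qi -> //]].
  by exists (N x).
by apply: fin_bigcup_measurable => //; exact: finite_finpred.
Qed.

Lemma prob_finite_valued (Q : pred I) :
  P [set x | Q (N x)]%classic = (\sum_(i | Q i) fine (P [set x | N x = i]%classic))%:E.
Proof.
have -> : [set x | Q (N x)]%classic =
    (\bigcup_(i in [set` Q]) [set x | N x = i])%classic.
  apply/seteqP; split => [x Qx|x [i /= Qi -> //]].
  by exists (N x).
rewrite (measure_fin_bigcup P (finite_finpred Q)) //; last first.
  by move=> i j _ _ [x [/= <- <-]].
rewrite -(bigfs _ (r := index_enum I)) ?index_enum_uniq //; last first.
  by move=> i _; rewrite mem_index_enum.
rewrite -sumEFin; apply: eq_bigr => i _.
by rewrite fineK // fin_num_measure.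
Qed.
End FiniteValued.

(** * Joint occurrence and non-occurrence of independent events *)

Section SignPatterns.
Import fintype boot.finset.
Variables (R : realType) (d : measure_display) (T : measurableType d).
Variables (P : probability T R) (I : finType) (J : {set I}) (A : I -> set T).
Hypothesis mA : forall i, i \in J -> measurable (A i).
Hypothesis indA : mutually_independent P J A.

Let sign_event (S N : {set I}) : set T :=
  (\bigcap_(i in [set` S]) A i `&` \bigcap_(i in [set` N]) ~` A i)%classic.

Let measurable_sign_event (S N : {set I}) : S \subset J -> N \subset J ->
  measurable (sign_event S N).
Proof.
move=> /subsetP SJ /subsetP NJ; apply: measurableI.
  by apply: fin_bigcap_measurable => [|i /SJ /mA //]; exact: finite_finpred.
apply: fin_bigcap_measurable => [|i /NJ /mA mAi]; first exact: finite_finpred.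
exact: measurableC.
Qed.

(** Induction on the number of complemented events: for [j] in [N], the event for [S] and [N :\ j]
    splits according to [A j], and the part inside [A j] is the event for [j |: S] and [N :\ j]. *)
Let prob_sign_event (S N : {set I}) : S \subset J -> N \subset J ->
  [disjoint S & N] ->
  P (sign_event S N) =
  ((\prod_(i in S) fine (P (A i))) * \prod_(i in N) (1 - fine (P (A i))))%:E.
Proof.
have [n] := ubnP #|N|; elim: n S N => // n IH S N.
have [-> _ SJ _ _|[j jN]] := set_0Vmem N.
  rewrite /sign_event (_ : [set` finset.set0]%classic = classical_sets.set0).
    by rewrite bigcap_set0 classical_sets.setIT indA // big_set0 mulr1.
  by apply/seteqP; split => // i /=; rewrite inE.
move=> Nn SJ NJ dSN; pose N' := N :\ j.
have N'n : (#|N'| < n)%N by move: Nn; rewrite (cardsD1 j) jN.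
have jJ : j \in J by exact: (subsetP NJ).
have jS : j \notin S by rewrite (disjointFl dSN).
have N'J : N' \subset J by apply: subset_trans NJ; exact: subsetDl.
have jSJ : j |: S \subset J by rewrite subUset sub1set jJ.
have dSN' : [disjoint S & N'].
  by apply: disjointWr dSN; exact: subsetDl.
have djSN' : [disjoint (j |: S) & N'].
  rewrite (eq_disjoint (B := [predU1 j & S])) ?disjointU1 ?inE ?eqxx //.
  by move=> i; rewrite !inE.
have : P (sign_event S N') = (P (sign_event S N' `\` A j)%classic +
    P (sign_event S N' `&` A j)%classic)%E.
  exact: measureDI (measurable_sign_event SJ N'J) (mA jJ).
have -> : (sign_event S N' `&` A j)%classic = sign_event (j |: S) N'.
  apply/seteqP; split => [x [[xS xN] xj]|x [xS xN]].
    split=> // i /=; rewrite !inE => /predU1P[-> //|iS]; exact: xS.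
  split; last by apply: xS; rewrite /= !inE eqxx.
  by split=> // i iS; apply: xS; rewrite /= !inE iS orbT.
have -> : (sign_event S N' `\` A j)%classic = sign_event S N.
  apply/seteqP; split => [x [[xS xN] xj]|x [xS xN]].
    split=> // i /= iN; have [-> //|ij] := eqVneq i j.
    by apply: xN; rewrite /= !inE ij.
  split; last exact: xN.
  by split=> // i /=; rewrite !inE => /andP[_ iN]; apply: xN.
rewrite (IH _ _ N'n SJ N'J dSN') (IH _ _ N'n jSJ N'J djSN').
rewrite -(fineK (fin_num_measure P _ (measurable_sign_event SJ NJ))) -EFinD.
move=> [] e; congr _%:E; move: e; rewrite big_setU1 //= (big_setD1 j jN) /= -/N'.
lra.
Qed.

(** Applied twice: to all edges, for the law of the graph, and to the vertices other than [a], for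
    the law of the neighbourhood of [a]. *)
Lemma prob_sign_pattern (s : {set I}) : s \subset J ->
  P [set x | forall i, i \in J -> (i \in s) = `[< A i x >] ]%classic =
  ((\prod_(i in s) fine (P (A i))) * \prod_(i in J :\: s) (1 - fine (P (A i))))%:E /\
  measurable [set x | forall i, i \in J -> (i \in s) = `[< A i x >] ]%classic.
Proof.
move=> sJ.
have -> : [set x | forall i, i \in J -> (i \in s) = `[< A i x >] ]%classic =
   sign_event s (J :\: s).
  apply/seteqP; split => [x xs|x [x1 x2] i iJ].
    split=> i /=; first by move=> iS; apply/asboolP; rewrite -xs // (subsetP sJ).
    by rewrite inE => /andP[is_ iJ]; apply/asboolPn; rewrite -xs.
  have [is_|is_] := boolP (i \in s); apply/esym; first by apply/asboolP; exact: x1.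
  by apply/asboolPn; apply: x2; rewrite /= inE is_.
split; last by apply: measurable_sign_event => //; exact: subsetDl.
rewrite prob_sign_event //; first exact: subsetDl.
by rewrite disjoints_subset; apply/subsetP => i is_; rewrite !inE is_.
Qed.
End SignPatterns.

Lemma vmax_ge (disp : Order.disp_t) (V : orderType disp) (m : nat)
  (hm : (0 < m)%N) (f : 'I_m -> V) (a : 'I_m) : (f a <= vmax hm f)%O.
Proof. exact: le_bigmax. Qed.

(** * Laws of the graph and of its degrees, and concentration of degree statistics *)

Section RandomGraph.
Import fintype boot.finset.
Variables (R : realType) (d : measure_display) (T : measurableType d).
Variables (P : probability T R) (m : nat) (p : {set 'I_m} -> R).
Variable G : T -> {set {set 'I_m}}.
Hypothesis hp : forall e : {set 'I_m}, e \in edges m -> 0 <= p e <= 1.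
Hypothesis hG : is_random_graph P p G.
Implicit Types (a : 'I_m) (g : {set {set 'I_m}}) (e : {set 'I_m}).

(* [bern] ranges over sets of arbitrary subsets of ['I_m]; non-edges get
   probability 0. *)
Definition edge_prob e : R := if e \in edges m then p e else 0.

Lemma edge_prob01 e : 0 <= edge_prob e <= 1.
Proof. by rewrite /edge_prob; case: ifP => [/hp //|_]; rewrite lexx ler01. Qed.

(** A set with a non-edge is never a value of [G], and has weight [0] because [edge_prob] vanishes
    there. Otherwise the event is a sign pattern of the edge events, and the non-edges contribute
    factors [1]. *)
Lemma prob_graph g : measurable [set x | G x = g]%classic /\
  fine (P [set x | G x = g]%classic) = bern edge_prob g.
Proof.
have [gE|gE] := boolP (g \subset edges m); last first.
  have [e eg eE] := subsetPn gE.
  have -> : [set x | G x = g]%classic = classical_sets.set0.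
    apply/seteqP; split => // x /= Gg; move: eE; apply/negP/negPn.
    by apply: (subsetP (rg_simple hG x)); rewrite Gg.
  split; first exact: measurable0.
  by rewrite measure0 /bern (bigD1 e) //= eg /edge_prob (negbTE eE) mul0r.
have -> : [set x | G x = g]%classic =
  [set x | forall e, e \in edges m -> (e \in g) = `[< edge_event G e x >] ]%classic.
  apply/seteqP; split => x /= => [<- e _|H]; first by rewrite asboolb.
  apply/setP => e; have [eE|eE] := boolP (e \in edges m).
    by rewrite H // asboolb.
  rewrite (negbTE (contra (subsetP (rg_simple hG x) e) eE)).
  by rewrite (negbTE (contra (subsetP gE e) eE)).
have [-> ?] := prob_sign_pattern (rg_measurable hG) (rg_indep hG) gE.
split=> //=; rewrite /bern big_mkcond [X in _ * X]big_mkcond -big_split /=.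
apply: eq_bigr => e _; rewrite in_setD /edge_prob.
have [eg|eg] /= := boolP (e \in g).
  by rewrite (subsetP gE) // (rg_prob hG) ?(subsetP gE) // mulr1.
by case: ifP => [eE|_]; rewrite ?(rg_prob hG) // mul1r ?subr0.
Qed.

Lemma measurable_graph (Q : pred {set {set 'I_m}}) :
  measurable [set x | Q (G x)]%classic.
Proof. by apply: measurable_finite_valued => g; have [] := prob_graph g. Qed.

Lemma prob_graph_event (Q : pred {set {set 'I_m}}) :
  P [set x | Q (G x)]%classic = (\sum_(g | Q g) bern edge_prob g)%:E.
Proof.
rewrite prob_finite_valued => [|g]; last by have [] := prob_graph g.
by congr _%:E; apply: eq_bigr => g _; have [] := prob_graph g.
Qed.

Definition neighbours a g : {set 'I_m} :=
  [set b | (b != a) && ([set a; b] \in g)].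

Definition neighbour_weight a (s : {set 'I_m}) : R :=
  (\prod_(b in s) p [set a; b]) * \prod_(b in [set~ a] :\: s) (1 - p [set a; b]).

Lemma star_edge a (b : 'I_m) : b \in [set~ a] -> [set a; b] \in edges m.
Proof. by rewrite !inE => ba; rewrite cards2 (eq_sym a) ba. Qed.

Lemma star_independent a :
  mutually_independent P [set~ a] (fun b => edge_event G [set a; b]).
Proof.
move=> S Sa.
have SE : [set [set a; b] | b in S] \subset edges m.
  by apply/subsetP => e /imsetP[b bS ->]; apply: star_edge; exact: (subsetP Sa).
have := rg_indep hG SE; rewrite big_imset /=; last first.
  by move=> b b' bS b'S; apply: edge_inj; exact: (subsetP Sa).
move=> <-; congr (P _); apply/seteqP; split => x H.
  by move=> e /= /imsetP[b bS ->]; exact: H.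
by move=> b /= bS; apply: H => /=; apply: imset_f.
Qed.

(** [q_eq] sums over sets of vertices rather than of edges; the law of the neighbourhood has its
    summands as point masses, and the degree is the size of the neighbourhood. *)
Lemma prob_neighbours a (Q : pred {set 'I_m}) :
  P [set x | Q (neighbours a (G x))]%classic =
  (\sum_(s : {set 'I_m} | (s \subset [set~ a]) && Q s) neighbour_weight a s)%:E.
Proof.
have mN s : measurable [set x | neighbours a (G x) = s]%classic.
  rewrite (_ : [set x | _]%classic = [set x | neighbours a (G x) == s]%classic).
    exact: (measurable_graph (fun g => neighbours a g == s)).
  by apply/seteqP; split => x /eqP.
rewrite (prob_finite_valued P mN Q).
congr _%:E; rewrite [LHS]big_mkcond [RHS]big_mkcond; apply: eq_bigr => s _.
rewrite andbC; case: (Q s) => //=.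
have [sa|sa] := boolP (s \subset [set~ a]); last first.
  rewrite (_ : [set x | _]%classic = classical_sets.set0) ?measure0 //.
  apply/seteqP; split => // x /= xs; move: sa; apply/negP/negPn; rewrite -xs.
  by apply/subsetP => b; rewrite !inE => /andP[].
have mA b : b \in [set~ a] -> measurable (edge_event G [set a; b]).
  by move=> /star_edge; exact: (rg_measurable hG).
rewrite (_ : [set x | _]%classic = [set x | forall b, b \in [set~ a]%SET ->
   (b \in s) = `[< edge_event G [set a; b]%SET x >] ]%classic); last first.
  apply/seteqP; split => x /= => [<- b|H].
    by rewrite !inE => ba; rewrite asboolb ba.
  apply/setP => b; rewrite inE; have [->|ba] /= := eqVneq b a.
    by apply/esym/negbTE; apply/negP => /(subsetP sa); rewrite !inE eqxx.
  by rewrite H ?asboolb // !inE.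
have [-> _] := prob_sign_pattern mA (@star_independent a) sa.
rewrite /= /neighbour_weight; congr (_ * _); apply: eq_bigr => b bs.
  by rewrite (rg_prob hG) // star_edge // (subsetP sa).
by rewrite (rg_prob hG) // star_edge //; move: bs; rewrite inE => /andP[].
Qed.

Lemma prob_degree_ge a (k : int) :
  P [set x | k <= (degree (G x) a)%:Z]%classic =
  (q_ge [set~ a] (fun b => p [set a; b]) k)%:E.
Proof.
rewrite (prob_neighbours a (fun s => k <= #|s|%:Z)); congr _%:E.
rewrite (partition_big (fun s : {set 'I_m} => inord #|s| : 'I_#|[set~ a]|.+1)
   (fun i => k <= i%:Z)) /=; last first.
  by move=> s /andP[sa ks]; rewrite inordK // ltnS subset_leq_card.
apply: eq_bigr => i ki; apply: eq_bigl => s.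
have [sa|//] := boolP (s \subset [set~ a]).
have sc : (#|s| < #|[set~ a]|.+1)%N by rewrite ltnS subset_leq_card.
rewrite -val_eqE /= inordK // eqz_nat.
by case: eqP => [->|]; rewrite ?ki ?andbF.
Qed.

Lemma prob_degree_ne a (k : int) :
  P [set x | (degree (G x) a)%:Z != k]%classic =
  (q_ne [set~ a] (fun b => p [set a; b]) k)%:E.
Proof.
have mk : measurable [set x | (degree (G x) a)%:Z == k]%classic.
  exact: (measurable_graph (fun g => (degree g a)%:Z == k)).
have -> : [set x | (degree (G x) a)%:Z != k]%classic =
   (~` [set x | (degree (G x) a)%:Z == k])%classic.
  by apply/seteqP; split => x /= /negP.
rewrite probability_setC //.
by rewrite (prob_neighbours a (fun s => #|s|%:Z == k)).
Qed.

Variables (w : 'I_m -> R) (S : 'I_m -> pred nat).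
Hypothesis w0 : forall a, 0 < w a.

Let event a : set T := [set x | S a (degree (G x) a)]%classic.

Let measurable_event a : measurable (event a).
Proof. exact: (measurable_graph (fun g => S a (degree g a))). Qed.

Lemma degree_statE_indic x :
  degree_stat w S (G x) = \sum_a w a * \1_(event a) x.
Proof.
apply: eq_bigr => a _; rewrite indicE; congr (_ * (nat_of_bool _)%:R).
by apply/idP/idP; rewrite in_setE.
Qed.

Lemma degree_meanE : degree_mean w S edge_prob = \sum_a w a * fine (P (event a)).
Proof.
apply: eq_bigr => a _; congr (_ * _).
by rewrite /event (prob_graph_event (fun g => S a (degree g a))).
Qed.

Lemma expectation_degree_stat :
  'E_P[fun x => degree_stat w S (G x)]%E = (degree_mean w S edge_prob)%:E.
Proof.
have mE := measurable_event.
rewrite unlock; under eq_integral do rewrite degree_statE_indic -sumEFin.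
rewrite ge0_integral_sum //=; last 2 first.
- move=> a; apply/measurable_EFinP; apply: measurable_funM => //.
- by move=> a x _; rewrite lee_fin mulr_ge0 // ltW.
rewrite degree_meanE -sumEFin; apply: eq_bigr => a _.
rewrite (integralZl_indic measurableT (fun=> event a)) //; last first.
  by rewrite ltNge ltW.
rewrite integral_indic // classical_sets.setIT EFinM fineK // fin_num_measure //.
Qed.

Lemma degree_stat_concentrated (c : R) : (0 < m)%N -> 0 < c ->
  (forall a, (0 < P (event a))%E) ->
  (forall a, exists2 k, tilt_bound w S edge_prob a k & w a + k <= c) ->
  concentrated P (fun x => degree_stat w S (G x)) (degree_mean w S edge_prob) c.
Proof.
move=> hm c0 P0 tb; set mu := degree_mean _ _ _.
have mu0 : 0 < mu.
  rewrite /mu degree_meanE (bigD1 (Ordinal hm)) //= ltr_pwDl //.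
    by rewrite mulr_gt0 // fine_gt0 // P0 ltey_eq fin_num_measure //.
  by apply: sumr_ge0 => a _; rewrite mulr_ge0 ?fine_ge0 // ltW.
have mgf s := degree_stat_mgf_le edge_prob01 w0 s c0 tb.
(* Markov's inequality for both tails at once: on the event,
   [expR (s * (degree_stat w S g - mu - t))] is at least [1]. *)
have tail (Q : pred {set {set 'I_m}}) (s t : R) :
    (forall g, Q g -> 0 <= s * (degree_stat w S g - mu - t)) ->
    (P [set x | Q (G x)]%classic
     <= (expR (mu / c * (expR (c * s) - 1) - s * (mu + t)))%:E)%E.
  move=> Qs; rewrite prob_graph_event lee_fin expRD.
  rewrite mulrC -ler_pdivrMl ?expR_gt0 // -expRN opprK.
  apply: le_trans (mgf s); rewrite mulr_sumr.
  rewrite [leRHS](bigID Q) /= -[leLHS]addr0; apply: lerD; last first.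
    by apply: sumr_ge0 => g _; rewrite mulr_ge0 ?expR_ge0 ?bern_ge0 //; exact: edge_prob01.
  apply: ler_sum => g /Qs h; rewrite mulrC ler_wpM2l ?bern_ge0 //.
    exact: edge_prob01.
  by rewrite ler_expR; lra.
apply: chernoff_concentrated => // s t s0.
  apply: (tail (fun g => t <= degree_stat w S g - mu)) => g h.
  by rewrite mulr_ge0 // subr_ge0.
apply: (tail (fun g => degree_stat w S g - mu <= t)) => g h.
by rewrite mulr_le0 // subr_le0.
Qed.
End RandomGraph.

Unset Implicit Arguments.

Theorem theorem3p1 (R : realType) (d : measure_display)
    (T : measurableType d) (P : probability T R)
    (m : nat) (hm : (0 < m)%N)
    (p : {set 'I_m} -> R)
    (hp : forall e : {set 'I_m}, e \in edges m -> 0 <= p e <= 1)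
    (G : T -> {set {set 'I_m}}) (hG : is_random_graph P p G)
    (w : 'I_m -> R) (hw : forall a, 0 < w a) (dg : 'I_m -> int) :
  (('E_P[Y_ge G w dg] = (mu_ge p w dg)%:E)%E /\
   (nonconstant_events P (ge_event G dg) ->
    concentrated P (Y_ge G w dg) (mu_ge p w dg) (c_ge w dg hm))) /\
  (('E_P[Y_ne G w dg] = (mu_ne p w dg)%:E)%E /\
   (nonconstant_events P (ne_event G dg) ->
    concentrated P (Y_ne G w dg) (mu_ne p w dg) (c_ne w hm))).
Proof.
have w_le a : w a <= vmax hm w by exact: vmax_ge.
have wm0 : 0 < vmax hm w by apply: lt_le_trans (w_le (Ordinal hm)).
split.
  pose S a n := dg a <= n%:Z.
  have -> : Y_ge G w dg = fun x => degree_stat w S (G x).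
    by apply/funext => x; rewrite degree_statE_indic.
  have -> : mu_ge p w dg = degree_mean w S (edge_prob p).
    rewrite (degree_meanE hG); apply: eq_bigr => a _.
    by rewrite (prob_degree_ge hG).
  split; first exact: expectation_degree_stat.
  (* A threshold [dg a <= 0] would make the event certain. Hence all thresholds are positive and can
     be read as natural numbers. *)
  move=> nc; have dg0 a : 0 < dg a.
    rewrite ltNge; apply/negP => da; have := nc a.
    rewrite (_ : ge_event G dg a = setT) ?probability_setT ?ltxx ?andbF //.
    by apply/seteqP; split => // x _; rewrite /ge_event /=; apply: le_trans da _.
  have D0 : 0 <= vmax hm dg + 1.
    by rewrite addr_ge0 // ltW // (lt_le_trans (dg0 (Ordinal hm))) // vmax_ge.
  apply: degree_stat_concentrated => //.
  - by rewrite /c_ge mulr_gt0 // ltr0z ltzD1 (le_trans (ltW (dg0 (Ordinal hm)))) // vmax_ge.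
  - by move=> a; have /andP[] := nc a.
  move=> a; exists (vmax hm w * (`|dg a|%N)%:R).
    apply: (@tilt_bound_ge _ _ _ _ _ _ (edge_prob01 hp) hw w_le a
      (fun b => `|dg b|%N)) => b n.
    by rewrite /S -{1}(gtz0_abs (dg0 b)) lez_nat.
  (* The summand [1] in [c_ge] accounts for the own weight [w a], and the maximal threshold for the
     other summands. *)
  rewrite /c_ge intrD mulrDr mulr1 addrC lerD //.
  by rewrite ler_pM2l // -[_%:R]/((`|dg a|%N : int)%:~R) ler_int gtz0_abs // vmax_ge.
pose S a n := n%:Z != dg a.
have -> : Y_ne G w dg = fun x => degree_stat w S (G x).
  by apply/funext => x; rewrite degree_statE_indic.
have -> : mu_ne p w dg = degree_mean w S (edge_prob p).
  rewrite (degree_meanE hG); apply: eq_bigr => a _.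
  by rewrite (prob_degree_ne hG).
split; first exact: expectation_degree_stat.
move=> nc; apply: degree_stat_concentrated => //.
- by rewrite /c_ne mulr_gt0.
- by move=> a; have /andP[] := nc a.
(* One maximal weight for the own summand and one for the others give the factor [2] of [c_ne]. *)
move=> a; exists (vmax hm w); first exact: (tilt_bound_ne (edge_prob01 hp) hw w_le).
by rewrite /c_ne mulr2n mulrDl mul1r lerD2r.
Qed.
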